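(* Let $\mathcal H$ be a complex Hilbert space of finite dimension $d\ge 3$, and let $w$ be a context-indexed probability assignment on $\mathfrak M_1(\mathcal H)$. The following are equivalent: (1) $w$ is complementary-unitary invariant; (2) $w$ is context independent; (3) there is a unique density operator $\rho$ on $\mathcal H$ such that $w(P,\mathsf M)=\operatorname{Tr}(\rho P)$ for every $\mathsf M\in\mathfrak M_1(\mathcal H)$ and every $P\in\mathsf M$. The first condition may equivalently be replaced by invariance under two-level complementary unitaries.
   Context: A projective measurement on $\mathcal H$ is an unordered finite family (set) $\mathsf M=\{P_1,\dots,P_m\}$ of nonzero pairwise orthogonal orthogonal projections on $\mathcal H$ with $\sum_{j=1}^m P_j=I$; it is maximal if every $P_j$ has rank one. $\mathfrak M_1(\mathcal H)$ is the set of maximal projective measurements. A context-indexed probability assignment on $\mathfrak M_1(\mathcal H)$ is a function $w:\{(P,\mathsf M):\mathsf M\in\mathfrak M_1(\mathcal H),\ P\in\mathsf M\}\to[0,1]$ with $\sum_{P\in\mathsf M}w(P,\mathsf M)=1$ for every $\mathsf M\in\mathfrak M_1(\mathcal H)$. It is context independent if $w(P,\mathsf M)=w(P,\mathsf N)$ whenever $P\in\mathsf M\cap\mathsf N$. $G_P=\{U\in\mathcal U(\mathcal H):Ux=x\text{ for every }x\in\operatorname{ran}P\}$, where $\mathcal U(\mathcal H)$ is the unitary group, and $U\mathsf M U^*:=\{UQU^*:Q\in\mathsf M\}$. The assignment $w$ is complementary-unitary invariant if $w(P,U\mathsf MU^* )=w(P,\mathsf M)$ for every $\mathsf M\in\mathfrak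 M_1(\mathcal H)$, every $P\in\mathsf M$ and every $U\in G_P$. Write $P^\perp=\operatorname{ran}(I-P)$; an element $U\in G_P$ is two-level if there is a subspace $L\subseteq P^\perp$ with $\dim L\le 2$ such that $U$ is the identity on the orthogonal complement of $L$ in $P^\perp$. Invariance under two-level complementary unitaries means the same equality required only for two-level $U\in G_P$. A density operator is a positive semidefinite operator of trace one. *)

(* Defs.v *)
From HB Require Import structures.
From mathcomp Require Import all_boot all_order all_algebra.
From mathcomp Require Import finmap.
From mathcomp Require Import boolp classical_sets reals.
From mathcomp Require Import complex.

Set Implicit Arguments.
Unset Strict Implicit.
Unset Printing Implicit Defensive.

Import Order.TTheory GRing.Theory Num.Theory Num.Def.
Local Open Scope ring_scope.
Local Open Scope fset_scope.

(* A finite-dimensional complex Hilbert space is a [vectType] over [R[i]], with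
   [R] the real numbers, equipped with a positive definite Hermitian form
   [ip], linear in its first argument.  Operators are elements of ['End(V)]. *)
Section Operators.
Variables (R : realType) (V : vectType R[i]) (ip : {dot V for conjC}).
Implicit Types (A P Q U : 'End(V)) (x y : V).

(* The existence of the adjoint, which makes the default value [0]
   irrelevant, is [adjointP] below. *)
Definition adjoint A : 'End(V) :=
  xget 0 [set B : 'End(V) | forall x y, ip (A x) y = ip x (B y)]%classic.

Definition unitary U : Prop :=
  (adjoint U \o U)%VF = \1%VF /\ (U \o adjoint U)%VF = \1%VF.

Definition orthogonal_projection P : Prop :=
  (P \o P)%VF = P /\ adjoint P = P.

(* Independent of the basis: see [lftrace_basis]. *)
Definition lftrace A : R[i] :=
  \sum_(i < \dim {:V}) coord (vbasis {:V}) i (A (vbasis {:V})`_i).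

(* The order of [R[i]] makes [0 <= z] say that [z] is real and nonnegative. *)
Definition density_operator A : Prop :=
  (forall x, 0 <= ip (A x) x) /\ lftrace A = 1.

Definition projective_measurement (M : {fset 'End(V)}) : Prop :=
  [/\ forall P, P \in M -> orthogonal_projection P /\ P <> 0,
      forall P Q, P \in M -> Q \in M -> P <> Q -> (P \o Q)%VF = 0
    & \sum_(P <- M) P = \1%VF].

Definition maximal_measurement (M : {fset 'End(V)}) : Prop :=
  projective_measurement M /\ (forall P, P \in M -> \dim (limg P) = 1%N).

Definition conj_measurement U (M : {fset 'End(V)}) : {fset 'End(V)} :=
  [fset (U \o (Q \o adjoint U))%VF | Q in M].

(* [G_P]: the unitaries fixing the range of [P] pointwise. *)
Definition complementary_unitary P U : Prop :=
  unitary U /\ (forall x, x \in limg P -> U x = x).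

Definition two_level_complementary_unitary P U : Prop :=
  complementary_unitary P U /\
  exists L : {vspace V},
    [/\ (L <= limg (\1 - P)%VF)%VS, (\dim L <= 2)%N
      & forall x, x \in limg (\1 - P)%VF ->
          (forall y, y \in L -> ip x y = 0) -> U x = x].

(* An assignment is a total function [w : 'End(V) -> {fset 'End(V)} -> R];
   only its values [w P M] with [M] maximal and [P \in M] are ever
   constrained or used. *)
Definition probability_assignment (w : 'End(V) -> {fset 'End(V)} -> R) : Prop :=
  forall M, maximal_measurement M ->
    (forall P, P \in M -> 0 <= w P M <= 1) /\ \sum_(P <- M) w P M = 1.

Definition context_independent (w : 'End(V) -> {fset 'End(V)} -> R) : Prop :=
  forall M N P, maximal_measurement M -> maximal_measurement N ->
    P \in M -> P \in N -> w P M = w P N.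

Definition invariant_under (G : 'End(V) -> 'End(V) -> Prop)
    (w : 'End(V) -> {fset 'End(V)} -> R) : Prop :=
  forall M P U, maximal_measurement M -> P \in M -> G P U ->
    w P (conj_measurement U M) = w P M.

Definition complementary_unitary_invariant :=
  invariant_under complementary_unitary.

Definition two_level_complementary_unitary_invariant :=
  invariant_under two_level_complementary_unitary.

Definition represents A (w : 'End(V) -> {fset 'End(V)} -> R) : Prop :=
  forall M P, maximal_measurement M -> P \in M ->
    (w P M)%:C%C = lftrace (A \o P)%VF.

Lemma ip_inj x y : (forall z, ip z x = ip z y) -> x = y.
Proof.
move=> h; apply/eqP; rewrite -subr_eq0 -(dnorm_eq0 ip).
by rewrite linearBr /= h subrr.
Qed.

Lemma riesz (f : {linear V -> R[i]^o}) : exists y, forall x, f x = ip x y.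
Proof.
pose n := \dim {:V}; pose b := vbasis {:V}.
pose G : 'M[R[i]]_n := \matrix_(i, j) ip b`_i b`_j.
have bE x : x = \sum_(i < n) coord b i x *: b`_i.
  by apply: coord_basis (memvf x); apply: vbasisP.
have Gu : G \in unitmx.
  rewrite -row_free_unit -kermx_eq0; apply/rowV0P => u /sub_kermxP uG.
  pose v := \sum_(i < n) u 0 i *: b`_i.
  have vb (j : 'I_n) : ip v b`_j = 0.
    have /matrixP/(_ 0 j) := uG; rewrite !mxE => <-.
    rewrite /v linear_sumlz /=; apply: eq_bigr => i _.
    by rewrite linearZl_LR !mxE.
  have v0 : v = 0.
    apply/eqP; rewrite -(dnorm_eq0 ip) {2}(bE v) linear_sumr big1 // => j _.
    by rewrite /= linearZr_LR /= vb mulr0.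
  apply/rowP => i; rewrite mxE.
  have fb : free b := basis_free (vbasisP {:V}).
  by move/freeP: fb => /(_ (fun i => u 0 i) v0 i).
pose c : 'cV[R[i]]_n := invmx G *m \col_i f b`_i.
exists (\sum_(j < n) (c j 0)^* *: b`_j)%R => x.
rewrite {1 2}(bE x) linear_sum linear_sumlz /=; apply: eq_bigr => i _.
rewrite linearZ linearZl_LR /=; congr (_ * _).
have : G *m c = \col_i f b`_i by rewrite mulKVmx.
move/matrixP/(_ i 0); rewrite !mxE => <-.
rewrite linear_sumr; apply: eq_bigr => j _ /=.
by rewrite linearZr_LR /= !mxE mulrC conjCK.
Qed.

Lemma adjointP A x y : ip (A x) y = ip x (adjoint A y).
Proof.
rewrite /adjoint; case: xgetP => [B _ /(_ x y)//|/= nB]; exfalso.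
have h (y0 : V) : exists z, forall x0, ip (A x0) y0 = ip x0 z.
  pose f x0 : R[i]^o := ip (A x0) y0.
  have fl : linear f.
    by move=> a u v; rewrite /f linearP linearPl.
  pose fL : {linear V -> R[i]^o} :=
    HB.pack f (GRing.isLinear.Build _ _ _ _ f fl).
  by have [z hz] := riesz fL; exists z => x0; rewrite -hz.
pose g y0 := projT1 (cid (h y0)).
have gP x0 y0 : ip (A x0) y0 = ip x0 (g y0) by rewrite /g; case: cid.
have gl : linear g.
  move=> a u v; apply: ip_inj => z; rewrite -gP !linearDr /= !linearZr_LR /=.
  by rewrite !gP.
pose gL : {linear V -> V} := HB.pack g (GRing.isLinear.Build _ _ _ _ g gl).
by apply: (nB (linfun gL)) => x0 y0; rewrite lfunE /= gP.
Qed.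

Lemma lftrace_basis n (b : n.-tuple V) A : basis_of {:V} b ->
  lftrace A = \sum_(i < n) coord b i (A b`_i).
Proof.
move=> bb; pose e := vbasis {:V}; have be : basis_of {:V} e := vbasisP _.
pose S := \matrix_(i < \dim {:V}, j < n) coord b j e`_i.
pose T := \matrix_(i < n, j < \dim {:V}) coord e j (A b`_i).
transitivity (\tr (S *m T)); last rewrite mxtrace_mulC.
  apply: eq_bigr => i _; rewrite !mxE.
  rewrite {1}(coord_basis bb (memvf e`_i)) linear_sum linear_sum.
  by apply: eq_bigr => j _; rewrite !linearZ !mxE.
apply: eq_bigr => i _; rewrite !mxE.
rewrite [in RHS](coord_basis be (memvf (A b`_i))) linear_sum.
by apply: eq_bigr => j _; rewrite linearZ !mxE.
Qed.

End Operators.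

(* Main.v *)
Require Import Defs.
From HB Require Import structures.
From mathcomp Require Import all_boot all_order all_algebra.
From mathcomp Require Import finmap boolp classical_sets reals.
From mathcomp Require Import topology normedtype sequences derive trigo.
From mathcomp Require Import complex ring lra.

(* Any maximal measurement [M] containing [P] is brought to any other, [N], by
   reflections that fix [M :&: N], so invariance under two-level unitaries
   already gives context independence.  A context independent assignment is a
   nonnegative frame function [f] on the unit sphere, and the rest is Gleason's
   theorem.

   On the sphere of [R^3] the argument is that of Cooke, Keane and Moran.  If
   [f] nearly attains its supremum [M] at [p], then [g = f + f \o r], with [r]
   the quarter turn about [p], is constant on the equator, hence almost
   decreasing away from the northernmost point of each great circle.  In the
   central projection from the sphere to the tangent plane at [p], moving away
   from that point is moving along a line perpendicular to the radius, and one
   can spiral along such lines from any point to any point farther from [p].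
   So [g] is almost a function of the latitude, and additivity on frames forces
   it to be almost affine in the squared cosine of the angle to [p].
   Compactness then shows that [f] attains its bounds, and a function which is
   extremal at two orthogonal points differs from a quadratic form by a
   function that is antisymmetric under permutations of the coordinates, which
   must vanish.

   In a complex space [quad x = f x * |x|^2] is thus a quadratic form on each
   real plane spanned by orthogonal vectors; this makes it Hermitian on complex
   planes, and the parallelogram law and polarization produce the density
   operator. *)

Set Implicit Arguments.
Unset Strict Implicit.
Unset Printing Implicit Defensive.

Import Order.TTheory GRing.Theory Num.Theory Num.Def.
Import numFieldNormedType.Exports.
Local Open Scope ring_scope.

(** * Frame functions on three-dimensional space *)

Section Space.
Variable R : realType.
Notation vec := (R * R * R)%type.
Implicit Types (u v w a b c : vec) (f g : vec -> R) (W x y z : R).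

Definition dot u v : R := u.1.1 * v.1.1 + u.1.2 * v.1.2 + u.2 * v.2.

Definition scale3 (k : R) u : vec := (k * u.1.1, k * u.1.2, k * u.2).

(** The linear map taking the standard basis to [a], [b], [c], hence an isometry when these are
    orthonormal. *)
Definition lin3 a b c u : vec :=
  (u.1.1 * a.1.1 + u.1.2 * b.1.1 + u.2 * c.1.1,
   u.1.1 * a.1.2 + u.1.2 * b.1.2 + u.2 * c.1.2,
   u.1.1 * a.2 + u.1.2 * b.2 + u.2 * c.2).

Definition orthonormal3 a b c : Prop :=
  [/\ dot a a = 1, dot b b = 1 & dot c c = 1] /\
  [/\ dot a b = 0, dot b c = 0 & dot a c = 0].

(* Functions on the sphere are represented by functions on nonzero vectors that
   depend only on the line through the vector. *)
Definition frame_function f W : Prop :=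
  (forall k u, k != 0 -> f (scale3 k u) = f u) /\
  (forall u v w, 0 < dot u u -> 0 < dot v v -> 0 < dot w w ->
     dot u v = 0 -> dot v w = 0 -> dot u w = 0 -> f u + f v + f w = W).

Lemma dot_ge0 u : 0 <= dot u u.
Proof. by rewrite !addr_ge0 // -expr2 sqr_ge0. Qed.

Lemma dotC u v : dot u v = dot v u.
Proof. by rewrite /dot; ring. Qed.

Lemma dot_lin3 a b c u v : orthonormal3 a b c ->
  dot (lin3 a b c u) (lin3 a b c v) = dot u v.
Proof.
move=> [[aa bb cc] [ab bc ac]].
transitivity (u.1.1 * v.1.1 * dot a a + u.1.2 * v.1.2 * dot b b
  + u.2 * v.2 * dot c c + (u.1.1 * v.1.2 + u.1.2 * v.1.1) * dot a b
  + (u.1.2 * v.2 + u.2 * v.1.2) * dot b c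
  + (u.1.1 * v.2 + u.2 * v.1.1) * dot a c); first by rewrite /dot /=; ring.
by rewrite aa bb cc ab bc ac /dot; ring.
Qed.

Lemma frame_lin3 a b c f W : orthonormal3 a b c ->
  frame_function f W -> frame_function (f \o lin3 a b c) W.
Proof.
move=> oabc [fZ fW]; split=> [k u k0|u v w u0 v0 w0 uv vw uw] /=.
  rewrite -[RHS](fZ k) //; congr f.
  by rewrite /lin3 /scale3 /=; congr (_,_,_); ring.
by apply: fW; rewrite dot_lin3.
Qed.

Lemma frameD f g W W' : frame_function f W -> frame_function g W' ->
  frame_function (fun u => f u + g u) (W + W').
Proof.
move=> [fZ fW] [gZ gW]; split=> [k u k0|u v w u0 v0 w0 uv vw uw].
  by rewrite fZ ?gZ.
by rewrite -(fW u v w) // -(gW u v w) //; ring.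
Qed.

Lemma frameN f W : frame_function f W -> frame_function (fun u => - f u) (- W).
Proof.
move=> [fZ fW]; split=> [k u k0|u v w u0 v0 w0 uv vw uw]; first by rewrite fZ.
by rewrite -(fW u v w) //; ring.
Qed.

(** Serves to bring any direction to the pole, since [lin3 a b c] sends the pole to [c]. *)
Lemma orthonormal_complete u : 0 < dot u u ->
  exists a b c k, [/\ orthonormal3 a b c, k != 0 & u = scale3 k c].
Proof.
case: u => -[x y] z u0.
pose N := Num.sqrt (dot (x, y, z) (x, y, z)).
have N0 : 0 < N by rewrite sqrtr_gt0.
have NE : N ^+ 2 = x * x + y * y + z * z by rewrite sqr_sqrtr // ltW.
have N1 : N != 0 by rewrite gt_eqF.
have Nu : N ^+ 2 != 0 by rewrite expf_neq0.
have [xy0|xy0] := eqVneq (x * x + y * y) 0.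
  have /andP[/eqP x0 /eqP y0] : (x == 0) && (y == 0).
    by move/eqP: xy0; rewrite -!expr2 paddr_eq0 ?sqr_ge0 // !sqrf_eq0.
  exists (1, 0, 0), (0, 1, 0), (0, 0, 1), z.
  move: u0; rewrite /orthonormal3 /dot /scale3 /= x0 y0 => u0.
  split; [|by apply: contraTneq u0 => ->; rewrite !mulr0 !addr0 ltxx
          |by congr (_,_,_); ring].
  by split; split; ring.
pose r := Num.sqrt (x * x + y * y).
have r0 : 0 < r.
  by rewrite sqrtr_gt0 lt_neqAle eq_sym xy0 addr_ge0 // -expr2 sqr_ge0.
have rE : r ^+ 2 = x * x + y * y.
  by rewrite sqr_sqrtr // addr_ge0 // -expr2 sqr_ge0.
have r1 : r != 0 by rewrite gt_eqF.
(* Away from the third axis, the first two vectors are the unit tangents to the parallel and to the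
   meridian through [u]. *)
exists (- y / r, x / r, 0), (- x * z / (r * N), - y * z / (r * N), r / N),
  (x / N, y / N, z / N), N.
split=> //; last by rewrite /scale3 /=; congr (_,_,_); field.
have ne : r * N != 0 by rewrite mulf_neq0.
rewrite /orthonormal3 /dot /=.
have E1 : x * x + y * y = r ^+ 2 by [].
have E2 : z * z = N ^+ 2 - r ^+ 2 by rewrite NE rE; ring.
split; split.
- rewrite (_ : _ + _ = (x * x + y * y) / r ^+ 2); last by field.
  by rewrite E1 divff // expf_neq0.
- rewrite (_ : _ + _ =
    ((x * x + y * y) * (z * z) + r ^+ 4) / (r * N) ^+ 2); last first.
    by field; rewrite ?r1 ?N1.
  rewrite E1 E2.
  rewrite (_ : r ^+ 2 * (N ^+ 2 - r ^+ 2) + r ^+ 4 = (r * N) ^+ 2); last by ring.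
  by rewrite divff // expf_neq0.
- rewrite (_ : _ + _ = (x * x + y * y + z * z) / N ^+ 2); last by field.
  by rewrite -NE divff.
- by field; rewrite ?r1 ?N1.
- rewrite (_ : _ + _ = z * (r ^+ 2 - (x * x + y * y)) / (r * N ^+ 2)); last first.
    by field; rewrite ?r1 ?N1.
  by rewrite E1 subrr mulr0 mul0r.
- by field; rewrite ?r1 ?N1.
Qed.

End Space.
(** * Spirals in the plane *)

Section Spiral.
Variable R : realType.
Implicit Types (x y t : R) (g : R -> R -> R).

Lemma sin_sqr_le x : sin x ^+ 2 <= x ^+ 2.
Proof.
wlog x0 : x / 0 <= x => [hw|].
  case: (leP 0 x) => [/hw//|/ltW x0]; rewrite -sqrrN -sinN -[leRHS]sqrrN.
  by apply: hw; rewrite oppr_ge0.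
have [|c _ +] := @MVT_segment R sin cos 0 x x0 (fun z _ => is_derive_sin z).

  by apply: continuous_subspaceT; exact: continuous_sin.
rewrite sin0 !subr0 => ->; rewrite exprMn ler_piMl ?sqr_ge0 //.
by rewrite -(cos2Dsin2 c) lerDl sqr_ge0.
Qed.

Lemma bernoulli_ineq x n : 0 <= x <= 1 -> 1 - n%:R * x <= (1 - x) ^+ n.
Proof.
move=> /andP[x0 x1]; elim: n => [|n IH]; first by rewrite expr0 mul0r subr0.
rewrite exprS; apply: le_trans (ler_wpM2l _ IH); last lra.
by rewrite -natr1; have := ler0n R n; nra.
Qed.

(** The bound on the angle makes the number of winding steps of the spiral independent of its
    endpoints. *)
Lemma unit_circle_angle x y : x ^+ 2 + y ^+ 2 = 1 ->
  exists2 t, t ^+ 2 <= pi ^+ 2 & cos t = x /\ sin t = y.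
Proof.
move=> xy1.
have x11 : -1 <= x <= 1 by have y2 := sqr_ge0 y; apply/andP; split; nra.
have cx : cos (acos x) = x by rewrite acosK // in_itv.
have := acos_ge0 x11; have := acos_lepi x11 => le_pi ge_0.
have tpi : acos x ^+ 2 <= pi ^+ 2 by rewrite lerXn2r // nnegrE (le_trans ge_0).
have sxy : sin (acos x) = Num.sqrt (y ^+ 2).
  by rewrite sin_acos //; congr Num.sqrt; lra.
case: (leP 0 y) => y0.
  by exists (acos x) => //; rewrite sxy sqrtr_sqr ger0_norm.
exists (- acos x); first by rewrite sqrrN.
by rewrite cosN sinN sxy sqrtr_sqr ltr0_norm // opprK.
Qed.

(* Winding outwards in [n] tangential steps multiplies the radius only by
   [cos (a / n) ^- n], which tends to [1]; two more tangential steps move the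
   point radially outwards. *)
Lemma tangent_spiral (rho : R) : 1 < rho -> exists n : nat, forall g (e : R),
  0 <= e ->
  (forall x y l, 0 < x ^+ 2 + y ^+ 2 -> g (x - l * y) (y + l * x) <= g x y + e) ->
  forall x y x' y', 0 < x ^+ 2 + y ^+ 2 ->
    rho * (x ^+ 2 + y ^+ 2) <= x' ^+ 2 + y' ^+ 2 -> g x' y' <= g x y + n%:R * e.
Proof.
move=> rho1.
have r0 : 0 < 1 - rho^-1 by rewrite subr_gt0 invf_lt1 // (lt_trans ltr01).
(* With [N] above [b] and steps of angle [al = a / N], where [a ^+ 2 <= pi ^+ 2], one gets
   [N * al ^+ 2 <= 1 - rho^-1]; Bernoulli's inequality then keeps [cos al ^+ (2 * N)] above
   [rho^-1]. *)
pose b := pi ^+ 2 / (1 - rho^-1) : R.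
have b0 : 0 <= b by rewrite divr_ge0 ?sqr_ge0 // ltW.
(* [N] is even so that [C ^+ N] is positive whatever the sign of the cosine [C]. *)
have [N [M NE] bN] : exists2 N, exists M, N = (2 * M)%N & b < N%:R.
  exists (2 * (Num.trunc b).+1)%N; first by eexists.
  by apply: lt_le_trans (truncnS_gt b) _; rewrite ler_nat leq_pmull.
have N0 : 0 < N%:R :> R by apply: le_lt_trans bN.
have N1 : 1 <= N%:R :> R by rewrite ler1n -(ltr0n R).
exists (N + 2)%N => g e e0 gstep x y x' y' xy0 xy'.
pose q := x ^+ 2 + y ^+ 2; pose q' := x' ^+ 2 + y' ^+ 2.
have q0 : 0 < q by [].
have q'0 : 0 < q' by apply: lt_le_trans xy'; rewrite mulr_gt0 // (lt_trans ltr01).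
pose r := Num.sqrt q; pose r' := Num.sqrt q'.
have r_gt0 : 0 < r by rewrite sqrtr_gt0.
have r'_gt0 : 0 < r' by rewrite sqrtr_gt0.
have rE : r ^+ 2 = x ^+ 2 + y ^+ 2 by rewrite sqr_sqrtr // ltW.
have r'E : r' ^+ 2 = x' ^+ 2 + y' ^+ 2 by rewrite sqr_sqrtr // ltW.
have rn : r != 0 by rewrite gt_eqF.
have r'n : r' != 0 by rewrite gt_eqF.
(* [a] is the angle from [(x, y)] to [(x', y')], read off their inner and cross products. *)
have [|a api [ca sa]] := @unit_circle_angle ((x * x' + y * y') / (r * r'))
    ((x * y' - y * x') / (r * r')).
  have E : (x * x' + y * y') ^+ 2 + (x * y' - y * x') ^+ 2 = (r * r') ^+ 2.
    by rewrite exprMn rE r'E; ring.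
  by rewrite !expr_div_n -mulrDl E divff // expf_neq0 // mulf_neq0.
pose al := a / N%:R; pose C := cos al; pose S := sin al.
have al2 : N%:R * al ^+ 2 <= 1 - rho^-1.
  have -> : N%:R * al ^+ 2 = a ^+ 2 / N%:R by rewrite /al; field; rewrite gt_eqF.
  rewrite ler_pdivrMr //; apply: le_trans api _.
  by rewrite mulrC -ler_pdivrMr // ltW.
have al1 : al ^+ 2 <= 1 - rho^-1.
  by apply: le_trans al2; rewrite ler_peMl // sqr_ge0.
have rho0 : 0 < rho^-1 by rewrite invr_gt0 (lt_trans ltr01).
have C2 : 1 - al ^+ 2 <= C ^+ 2 by rewrite /C cos2sin2 lerB // sin_sqr_le.
have C0 : C != 0 by rewrite -sqrf_eq0 gt_eqF //; lra.
have CN : rho^-1 <= (C ^+ 2) ^+ N.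
  apply: (@le_trans _ _ ((1 - al ^+ 2) ^+ N)); last first.
    by rewrite lerXn2r ?nnegrE //; [lra|rewrite sqr_ge0].
  apply: le_trans (bernoulli_ineq N _); first lra.
  by rewrite sqr_ge0 /=; lra.
(* A tangential step of ratio [S / C], the tangent of [al], rotates by [al] and scales by [C^-1]. *)
have winding k : g ((cos (k%:R * al) * x - sin (k%:R * al) * y) / C ^+ k)
    ((sin (k%:R * al) * x + cos (k%:R * al) * y) / C ^+ k) <= g x y + k%:R * e.
  elim: k => [|k IH].
    by rewrite !mul0r cos0 sin0 expr0 !divr1 !mul0r !mul1r subr0 add0r addr0.
  rewrite -natr1 [(_ + 1) * e]mulrDl mul1r addrA.
  apply: le_trans (lerD IH (lexx e)).
  set X := (X in g X _ + e); set Y := (Y in g _ Y + e).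
  apply: le_trans (gstep X Y (S / C) _); last first.
    rewrite (_ : _ + _ = q / (C ^+ k) ^+ 2).
      by rewrite divr_gt0 // exprn_even_gt0 // expf_neq0 ?orbT.
    rewrite (_ : q = q * (cos (k%:R * al) ^+ 2 + sin (k%:R * al) ^+ 2)).
      by rewrite /X /Y /q; field; rewrite expf_neq0.
    by rewrite cos2Dsin2 mulr1.
  rewrite [(_ + 1) * al]mulrDl mul1r cosD sinD -/C -/S exprS le_eqVlt.
  apply/orP; left; apply/eqP.
  by congr (g _ _); rewrite /X /Y; field; rewrite C0 expf_neq0.
have al_a : N%:R * al = a by rewrite /al mulrC divfK // gt_eqF.
pose X := x' * r / (r' * C ^+ N); pose Y := y' * r / (r' * C ^+ N).
have {winding} gXY : g X Y <= g x y + N%:R * e.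
  have := winding N; rewrite al_a ca sa.
  have CN0 : C ^+ N != 0 by rewrite expf_neq0.
  rewrite (_ : _ / _ = X); last first.
    transitivity (x' * (x ^+ 2 + y ^+ 2) / (r * r' * C ^+ N)).
      by field; rewrite rn r'n CN0.
    by rewrite -rE /X; field; rewrite rn r'n CN0.
  rewrite (_ : _ / _ = Y) //.
  transitivity (y' * (x ^+ 2 + y ^+ 2) / (r * r' * C ^+ N)).
    by field; rewrite rn r'n CN0.
  by rewrite -rE /Y; field; rewrite rn r'n CN0.
pose m := r' * C ^+ N / r.
have CNgt0 : 0 < C ^+ N by rewrite NE exprM exprn_gt0 // exprn_even_gt0 //= C0.
have m0 : 0 < m by rewrite divr_gt0 // mulr_gt0.
have m1 : 1 <= m.
  rewrite -(@expr_ge1 _ 2%N) ?(ltW m0) // /m expr_div_n exprMn rE r'E.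
  rewrite ler_pdivlMr // mul1r -/q -/q' -exprM mulnC exprM.
  apply: (@le_trans _ _ (q' * rho^-1)); last by rewrite ler_wpM2l // ltW.
  by rewrite ler_pdivlMr ?(lt_trans ltr01) // mulrC.
(* Steps of ratio [l] and then [- l] multiply the point by [1 + l ^+ 2 = m], the dilation still
   missing. *)
pose l := Num.sqrt (m - 1).
have lE : l ^+ 2 = m - 1 by rewrite sqr_sqrtr // subr_ge0.
have XY0 : 0 < X ^+ 2 + Y ^+ 2.
  rewrite (_ : _ + _ = q' * (r / (r' * C ^+ N)) ^+ 2); last first.
    by rewrite /X /Y /q'; ring.
  by rewrite mulr_gt0 // exprn_gt0 // divr_gt0 // mulr_gt0.
have s1 := gstep X Y l XY0.
have := gstep (X - l * Y) (Y + l * X) (- l).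
rewrite (_ : _ ^+ 2 + _ ^+ 2 = (1 + l ^+ 2) * (X ^+ 2 + Y ^+ 2)); last by ring.
rewrite (_ : _ - _ = (1 + l ^+ 2) * X); last by ring.
rewrite (_ : _ + - l * _ = (1 + l ^+ 2) * Y); last by ring.
rewrite lE [1 + _]addrC subrK mulr_gt0 // => /(_ isT).
have -> : m * X = x' by rewrite /m /X; field; rewrite rn r'n gt_eqF.
have -> : m * Y = y' by rewrite /m /Y; field; rewrite rn r'n gt_eqF.
by rewrite natrD; lra.
Qed.

End Spiral.
(** * Behaviour near a maximum *)

Section Polar.
Variable R : realType.
Notation vec := (R * R * R)%type.
Implicit Types (u v w : vec) (g : vec -> R) (W A c e x y z : R).

Definition pole : vec := (0, 0, 1).

Lemma dot_e1 : 0 < dot ((1, 0, 0) : vec) (1, 0, 0).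
Proof. by rewrite /dot /= !mulr0 !addr0 mulr1 ltr01. Qed.

Lemma dot_e2 : 0 < dot ((0, 1, 0) : vec) (0, 1, 0).
Proof. by rewrite /dot /= !mulr0 add0r addr0 mulr1 ltr01. Qed.

Lemma dot_pole : 0 < dot pole pole.
Proof. by rewrite /dot /= !mulr0 !add0r mulr1 ltr01. Qed.

(** The squared cosine of the angle between [u] and the pole, in a form homogeneous of degree
    zero. *)
Definition cosq u : R := u.2 ^+ 2 / dot u u.

Lemma cosq_ge0 u : 0 <= cosq u.
Proof. by rewrite divr_ge0 ?sqr_ge0 ?dot_ge0. Qed.

Lemma cosq_le1 u : cosq u <= 1.
Proof.
rewrite /cosq; have := dot_ge0 u; rewrite le_eqVlt => /predU1P[<-|u0].
  by rewrite invr0 mulr0 ler01.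
rewrite ler_pdivrMr // mul1r /dot.
by have := sqr_ge0 u.1.1; have := sqr_ge0 u.1.2; nra.
Qed.

(* [t] is the direction of [w^perp] closest to the pole. *)
Lemma orthogonal_top w : 0 < dot w w -> exists t d,
  [/\ 0 < dot t t, 0 < dot d d & d.2 = 0] /\
  [/\ dot w t = 0, dot t d = 0, dot w d = 0 & cosq t = 1 - cosq w].
Proof.
case: w => -[x y] z; rewrite /cosq /dot /= => w0.
have [xy|xy] := eqVneq (x ^+ 2 + y ^+ 2) 0.
  have /andP[/eqP x0 /eqP y0] : (x == 0) && (y == 0).
    by move/eqP: xy; rewrite paddr_eq0 ?sqr_ge0 // !sqrf_eq0.
  exists (1, 0, 0), (0, 1, 0) => /=; move: w0; rewrite x0 y0 => w0.
  split; split; rewrite ?(mulr0, mul0r, addr0, add0r, mulr1, ltr01) //.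
  by rewrite expr0n /= mul0r -expr2 divff ?subrr // expr2 gt_eqF //; lra.
have xy0 : 0 < x ^+ 2 + y ^+ 2 by rewrite lt_neqAle eq_sym xy addr_ge0 ?sqr_ge0.
have N : 0 < x ^+ 2 + y ^+ 2 + z ^+ 2 by rewrite !expr2.
(* [t] is [|w|^2] times the projection of the pole onto the plane orthogonal to [w]; [d] is
   horizontal and orthogonal to both. *)
exists (- x * z, - y * z, x ^+ 2 + y ^+ 2), (- y, x, 0) => /=.
split; split => //; try ring.
- rewrite [ltRHS](_ : _ =
    (x ^+ 2 + y ^+ 2) * (x ^+ 2 + y ^+ 2 + z ^+ 2)); last by ring.
  by rewrite mulr_gt0.
- by rewrite mulrNN mul0r addr0 -!expr2 addrC.
- rewrite -!expr2 [X in _ / X = _](_ : _ =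
    (x ^+ 2 + y ^+ 2) * (x ^+ 2 + y ^+ 2 + z ^+ 2)); last by ring.
  by field; rewrite xy gt_eqF.
Qed.

(** * Frame functions nearly maximal at the pole and constant on the equator *)

Section NearMaximum.
Variables (g : vec -> R) (W A c e : R).
Hypotheses (gW : frame_function g W) (gA : forall u, 0 < dot u u -> g u <= A).
Hypotheses (gpole : A - e <= g pole) (e0 : 0 <= e).
Hypothesis gc : forall u, 0 < dot u u -> u.2 = 0 -> g u = c.

Lemma polar_weight : W = g pole + 2 * c.
Proof.
have := gc dot_e1 erefl; have := gc dot_e2 erefl.
case: gW => _ /(_ _ _ _ dot_e1 dot_e2 dot_pole) <-; first by lra.
1-3: by rewrite /dot /= !(mulr0, mul0r, addr0).
Qed.

(** The third vector of the frame lies on the equator, where [g] is [c]. *)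
Lemma complement_top w t d : 0 < dot w w -> 0 < dot t t -> 0 < dot d d ->
  d.2 = 0 -> dot w t = 0 -> dot t d = 0 -> dot w d = 0 ->
  g w + g t = g pole + c.
Proof.
move=> w0 t0 d0 d2 wt te we.
case: gW => _ /(_ w t d w0 t0 d0 wt te we).
by rewrite polar_weight (gc d0) //; lra.
Qed.

Lemma pole_cosq1 u : 0 < dot u u -> cosq u = 1 -> g u = g pole.
Proof.
case: u => -[x y] z u0 u1.
have : z ^+ 2 = dot (x, y, z) (x, y, z).
  by rewrite -[RHS]mul1r -u1 /cosq /= divfK // gt_eqF.
rewrite /dot /= => zz; have /andP[/eqP x0 /eqP y0] : (x == 0) && (y == 0).
  have /eqP : x ^+ 2 + y ^+ 2 = 0 by lra.
  by rewrite paddr_eq0 ?sqr_ge0 // !sqrf_eq0.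
move: u0; rewrite /dot /= x0 y0 => z0.
have zn : z != 0 by apply: contraTneq z0 => ->; rewrite !mulr0 !addr0 ltxx.
by case: gW => /(_ z pole zn) <- _; rewrite /scale3 /= !mulr0 mulr1.
Qed.

(** The top [t] of the plane orthogonal to [u] satisfies [g t <= A <= g pole + e], while
    [g u + g t = g pole + c]. *)
Lemma polar_lower u : 0 < dot u u -> c - e <= g u.
Proof.
move=> u0; have [t [d [[t0 d0 d2] [ut te ue _]]]] := orthogonal_top u0.
have := complement_top u0 t0 d0 d2 ut te ue; have := gA t0.
by have := gpole; lra.
Qed.

(** Both points are orthogonal to [n]. Completing each to a frame with [n] and comparing gives [g]
    at the new point plus [g t] equal to [g] at the old point plus [c], and [g t] is at least
    [c - e]. *)
Lemma polar_step x y l : 0 < x ^+ 2 + y ^+ 2 ->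
  g (x - l * y, y + l * x, 1) <= g (x, y, 1) + e.
Proof.
move=> xy0; pose r := x ^+ 2 + y ^+ 2.
pose n : vec := (- x, - y, r).
pose t : vec := (l * r * x + (1 + r) * y, l * r * y - (1 + r) * x, l * r).
have r0 : 0 < r by [].
have n0 : 0 < dot n n.
  have -> : dot n n = r + r ^+ 2 by rewrite /dot /n /r /=; ring.
  by have := exprn_gt0 2 r0; lra.
have s0 (X Y : R) : 0 < dot (X, Y, 1) (X, Y, 1).
  by rewrite /dot /= mulr1; have := sqr_ge0 X; have := sqr_ge0 Y; nra.
have t0 : 0 < dot t t.
  have -> : dot t t = (1 + r) * r * (l ^+ 2 * r + (1 + r)).
    by rewrite /dot /t /r /=; ring.
  apply: mulr_gt0; first by rewrite mulr_gt0 //; lra.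
  by have l2 := sqr_ge0 l; nra.
have d0 : 0 < dot ((- y, x, 0) : vec) (- y, x, 0).
  by rewrite /dot /= mulrNN mulr0 addr0 -!expr2 addrC.
have := gc d0 erefl; have := polar_lower t0.
case: gW => _ fW.
have := fW (x, y, 1) (- y, x, 0) n (s0 _ _) d0 n0.
have := fW (x - l * y, y + l * x, 1) t n (s0 _ _) t0 n0.
move=> H1 H2 gt ge.
have {}H1 : g (x - l * y, y + l * x, 1) + g t + g n = W.
  by apply: H1; rewrite /dot /t /n /r /=; ring.
have {}H2 : g (x, y, 1) + g (- y, x, 0) + g n = W.
  by apply: H2; rewrite /dot /n /r /=; ring.
lra.
Qed.

End NearMaximum.

Definition nearly_maximal g (W A c e : R) : Prop :=
  [/\ frame_function g W, forall u, 0 < dot u u -> g u <= A,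
      A - e <= g pole, 0 <= e &
      forall u, 0 < dot u u -> u.2 = 0 -> g u = c].

(** In the central projection [cosq] becomes [1 / (1 + |.|^2)], and [tangent_spiral] leads from [v]
    out to [u]. The pole and the equator are treated apart, at a cost of at most one [e]. That [n]
    is chosen before [g] is essential for the compactness argument. *)
Lemma polar_mono (x y : R) : 0 < x -> x < y -> y < 1 -> exists n : nat,
  forall g W A c e, nearly_maximal g W A c e ->
  forall u v, 0 < dot u u -> 0 < dot v v -> cosq u <= x -> y <= cosq v ->
  g u <= g v + n%:R * e.
Proof.
move=> x0 xy y1.
have y0 : 0 < y by apply: lt_trans xy.
have d0 : 0 < x * (1 - y) by rewrite mulr_gt0 // subr_gt0.
(* The squared radii are at least [(1 - x) / x] for [u] and at most [(1 - y) / y] for [v]; this is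
   the ratio of the two bounds. *)
have [|n hn] := @tangent_spiral R ((1 - x) * y / (x * (1 - y))).
  by rewrite ltr_pdivlMr // mul1r; nra.
exists n.+1 => g W A c e [gW gA gp e0 gc] u v u0 v0 ux yv.
have ne0 : 0 <= n%:R * e by rewrite mulr_ge0.
rewrite -natr1 mulrDl mul1r.
have [v1|v1] := eqVneq (cosq v) 1.
  by rewrite (pole_cosq1 gW v0 v1); have := gA _ u0; lra.
have [u1|u1] := eqVneq u.2 0.
  by rewrite (gc _ u0 u1); have := polar_lower gW gA gp gc v0; lra.
have v2 : v.2 != 0.
  by apply: contraTneq yv; rewrite /cosq => ->; rewrite expr0n mul0r -ltNge.
have proj w : w.2 != 0 -> g w = g (w.1.1 / w.2, w.1.2 / w.2, 1).
  move=> w2; case: gW => /(_ w.2 (w.1.1 / w.2, w.1.2 / w.2, 1) w2) <- _.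
  by rewrite /scale3 /= mulr1 ![w.2 * _]mulrC !divfK //; case: (w) => -[].
have dotE w : w.2 != 0 -> 0 < dot w w ->
    cosq w * (1 + ((w.1.1 / w.2) ^+ 2 + (w.1.2 / w.2) ^+ 2)) = 1.
  move=> w2 w0; rewrite /cosq /dot; field; rewrite w2 /=.
  by move: w0; rewrite /dot => /gt_eqF ->.
have {dotE} := (dotE u u1 u0, dotE v v2 v0).
rewrite (proj _ u1) (proj _ v2).
set X := u.1.1 / _; set Y := u.1.2 / _; set X' := v.1.1 / _; set Y' := v.1.2 / _.
case=> eu ev.
have XY' : 0 < X' ^+ 2 + Y' ^+ 2.
  rewrite lt_neqAle addr_ge0 ?sqr_ge0 // andbT eq_sym.
  by apply: contra_neq v1 => E; move: ev; rewrite E addr0 mulr1.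
apply: (@le_trans _ _ (g (X', Y', 1) + n%:R * e)); last by lra.
apply: (hn (fun X Y => g (X, Y, 1)) e e0 _ X' Y' X Y XY') => [X1 Y1 l XY1|].
  exact: polar_step gW gA gp gc _ _ _ XY1.
have := addr_ge0 (sqr_ge0 X) (sqr_ge0 Y).
move: XY' ev eu; set q' := _ + Y' ^+ 2; set q := _ + Y ^+ 2 => XY' ev eu q0.
have hq' : y * q' <= 1 - y.
  have q'1 : 0 <= 1 + q' by lra.
  by have := ler_wpM2r q'1 yv; rewrite ev; lra.
have hq : 1 - x <= x * q.
  have q1 : 0 <= 1 + q by lra.
  by have := ler_wpM2r q1 ux; rewrite eu; lra.
rewrite mulrAC ler_pdivrMr //.
apply: (@le_trans _ _ ((1 - x) * (1 - y))).
  by rewrite -mulrA ler_wpM2l //; lra.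
by rewrite mulrA [q * x]mulrC ler_wpM2r //; lra.
Qed.

(** Additivity of [g - c] in [cosq]: complete [u] to a frame [u], [v], [w] with [cosq v = x], and
    replace [w] by the top [t] of its orthogonal plane, for which [cosq t = 1 - cosq w]. *)
Lemma polar_chain_step g W A c e u x : nearly_maximal g W A c e ->
  0 < dot u u -> 0 <= x -> cosq u + x <= 1 -> exists v t,
  [/\ 0 < dot v v, 0 < dot t t, cosq v = x, cosq t = cosq u + x &
      g t + c = g u + g v].
Proof.
move=> [gW gA gp e0 gc] u0 x0 ux.
have [w [v [[w0 v0] [uv vw uw] [vx wx]]]] : exists w v,
    [/\ 0 < dot w w /\ 0 < dot v v,
        [/\ dot u v = 0, dot v w = 0 & dot u w = 0] &
        cosq v = x /\ cosq w = 1 - cosq u - x].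
  case: u u0 ux => -[p q] z u0 ux.
  pose r := p ^+ 2 + q ^+ 2; pose N := r + z ^+ 2.
  have NE : dot (p, q, z) (p, q, z) = N by rewrite /dot /N /r /=; ring.
  have N0 : 0 < N by rewrite -NE.
  have r0 : 0 <= r by rewrite addr_ge0 ?sqr_ge0.
  have xr : x * N <= r.
    move: ux; rewrite /cosq NE /= -ler_pdivlMr // => ux.
    have : z ^+ 2 / N + x <= 1 by [].
    rewrite -lerBrDl => /le_trans; apply.
    by rewrite /N -[1](@divff _ N) ?gt_eqF // -mulrBl /N addrK.
  case: (eqVneq r 0) => r1.
    have /andP[/eqP p0 /eqP q0] : (p == 0) && (q == 0).
      by move/eqP: r1; rewrite paddr_eq0 ?sqr_ge0 // !sqrf_eq0.
    have x1 : x = 0 by apply/le_anti; rewrite x0 -(ler_pM2r N0) mul0r -r1 xr.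
    exists (1, 0, 0), (0, 1, 0); rewrite /cosq NE /dot /= p0 q0 x1.
    rewrite ?(mulr0, mul0r, addr0, add0r, mulr1, ltr01, expr0n, subr0) /=.
    have NZ : N = z ^+ 2 by rewrite /N r1 add0r.
    by split=> //; split=> //; rewrite NZ divff ?subrr // -NZ gt_eqF.
  have rgt0 : 0 < r by rewrite lt_neqAle eq_sym r1.
  pose al := Num.sqrt x; pose be := Num.sqrt (r - x * N).
  have alE : al ^+ 2 = x by rewrite sqr_sqrtr.
  have beE : be ^+ 2 = r - x * N by rewrite sqr_sqrtr // subr_ge0.
  (* With [t0 = (- p z, - q z, r)] and [d = (- q, p, 0)], which span the plane orthogonal to [u],
     these are [be t0 - al N d] and [al t0 + be d]; [be] is chosen so that the second has squared
     length [r ^+ 2]. *)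
  exists (- be * p * z + al * N * q, - be * q * z - al * N * p, be * r),
    (- al * p * z - be * q, - al * q * z + be * p, al * r).
  rewrite /cosq NE /=.
  have -> : dot
     ((- be * p * z + al * N * q, - be * q * z - al * N * p, be * r) : vec)
     (- be * p * z + al * N * q, - be * q * z - al * N * p, be * r) = r ^+ 2 * N.
    transitivity (r * N * (be ^+ 2 + al ^+ 2 * N)).
      by rewrite /dot /N /r /=; ring.
    by rewrite alE beE; ring.
  have -> : dot ((- al * p * z - be * q, - al * q * z + be * p, al * r) : vec)
    (- al * p * z - be * q, - al * q * z + be * p, al * r) = r ^+ 2.
    transitivity (r * (be ^+ 2 + al ^+ 2 * N)).
      by rewrite /dot /N /r /=; ring.
    by rewrite alE beE; ring.
  split; first by rewrite mulr_gt0 ?exprn_gt0.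
    by split; rewrite /dot /N /r /=; ring.
  rewrite !exprMn alE beE; split; first by rewrite mulfK // expf_neq0.
  by rewrite -(addrK r (z ^+ 2)) [z ^+ 2 + r]addrC -/N; field; rewrite r1 gt_eqF.
have [t [d [[t0 d0 d2] [wt te we tE]]]] := orthogonal_top w0.
exists v, t; split=> //; first by rewrite tE wx; ring.
have := complement_top gW gc w0 t0 d0 d2 wt te we.
case: (gW) => _ /(_ u v w u0 v0 w0 uv vw uw).
by rewrite (polar_weight gW gc); lra.
Qed.

(** Climbs from the equator, where [g - c] vanishes, by [k] applications of [polar_chain_step]. *)
Lemma polar_chain g W A c e (x lo hi : R) : nearly_maximal g W A c e ->
  0 <= x ->
  (forall v, 0 < dot v v -> cosq v = x -> lo <= g v - c <= hi) ->
  forall k : nat, k%:R * x <= 1 ->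
  exists u, [/\ 0 < dot u u, cosq u = k%:R * x &
                k%:R * lo <= g u - c <= k%:R * hi].
Proof.
move=> gn x0 gx; elim=> [_|k IH kx].
  exists (1, 0, 0); split; first exact: dot_e1.
    by rewrite /cosq /= expr0n !mul0r.
  by case: gn => _ _ _ _ gc; rewrite gc ?dot_e1 // !mul0r subrr lexx.
move: kx; rewrite -natr1 mulrDl mul1r => kx.
have [|u [u0 uk /andP[ulo uhi]]] := IH; first by apply: le_trans kx; lra.
have [|v [t [v0 t0 vx tE gt]]] := polar_chain_step gn u0 x0; first by rewrite uk.
exists t; split=> //; first by rewrite tE uk.
by have /andP[vlo vhi] := gx _ v0 vx; apply/andP; split; lra.
Qed.

(** Climb in [k] steps of height [1 / k] up to [cosq v = 1], where [g v <= A]. By [polar_mono] each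
    step gains at least [g u - n e - c], so [k] times this is at most [A - c]. *)
Lemma polar_small (x : R) (k : nat) : 0 < x -> (1 < k)%N -> x < k%:R^-1 ->
  exists n : nat, forall g W A c e, nearly_maximal g W A c e ->
  forall u, 0 < dot u u -> cosq u <= x -> g u - c <= (A - c) / k%:R + n%:R * e.
Proof.
move=> x0 k1 xk.
have k0 : 0 < k%:R :> R by rewrite ltr0n (ltn_trans _ k1).
have [|n hn] := polar_mono x0 xk; first by rewrite invf_lt1 // ltr1n.
exists n => g W A c e gn u u0 ux.
have [|||v [v0 vk /andP[lo _]]] :=
  @polar_chain g W A c e k%:R^-1 (g u - n%:R * e - c) (A - c) gn _ _ k.
- by rewrite invr_ge0 ltW.
- move=> v v0 vk; apply/andP; split; last by case: gn => _ /(_ _ v0) gA _ _ _; lra.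
  by have := hn _ _ _ _ _ gn _ _ u0 v0 ux; rewrite vk => /(_ (lexx _)); lra.
- by rewrite mulfV ?gt_eqF.
rewrite -lerBlDr ler_pdivlMr // mulrC.
by case: gn => _ /(_ _ v0) gA _ _ _; lra.
Qed.

(** For the upper bound, approximate [cosq u] from above by fractions [l / N] and climb in [l] steps
    of height [1 / N]; no error accumulates since [e] is zero. The upper bound on the complementary
    direction, where [cosq] is [1 - cosq u], is the lower bound. *)
Lemma polar_exact g W A c : nearly_maximal g W A c 0 ->
  forall u, 0 < dot u u -> g u = c + cosq u * (A - c).
Proof.
move=> gn; have [gW gA gp _ gc] := gn.
have gpole : g pole = A by apply/le_anti; rewrite (gA _ dot_pole) /= -[A]subr0.
have upper u : 0 < dot u u -> g u - c <= cosq u * (A - c).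
  move=> u0; set a := cosq u.
  have a0 : 0 <= a by apply: cosq_ge0.
  have Ac : 0 <= A - c.
    by rewrite subr_ge0 -(gc _ dot_e1 erefl); apply: gA dot_e1.
  have [a1|a1] := eqVneq a 1; first by rewrite (pole_cosq1 gW u0 a1) gpole a1 mul1r.
  have {}a1 : a < 1 by rewrite lt_neqAle a1 cosq_le1.
  have [az|az] := eqVneq a 0.
    rewrite az mul0r gc ?subrr //; move/eqP: az.
    by rewrite /a /cosq mulf_eq0 invr_eq0 (gt_eqF u0) orbF sqrf_eq0 => /eqP.
  have {az}a_gt0 : 0 < a by rewrite lt_neqAle eq_sym az.
  rewrite leNgt; apply/negP => gt_u.
  pose d := g u - c - a * (A - c).
  have d0 : 0 < d by rewrite subr_gt0.
  have a1' : 0 < 1 - a by rewrite subr_gt0.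
  have Gu : 0 < g u - c.
    by apply: le_lt_trans gt_u; rewrite mulr_ge0.
  (* The three terms ensure [d * N > (A - c) + (g u - c)], [l / N < 1] and [1 < N - 1]. The first
     contradicts [(g u - c) * (N - 1) <= (a * N + 1) * (A - c)], obtained at the end. *)
  pose B := (A - c + (g u - c)) / d + (1 - a)^-1 + 3.
  have [N BN] : exists N : nat, B < N%:R.
    by exists (Num.trunc B).+1; apply: truncnS_gt.
  have B1 : 0 <= (A - c + (g u - c)) / d by rewrite divr_ge0 ?ltW //; lra.
  have B2 : 0 < (1 - a)^-1 by rewrite invr_gt0.
  have N3 : 3 < N%:R :> R by apply: le_lt_trans BN; rewrite /B; lra.
  have N0 : 0 < N%:R :> R by lra.
  have Nd : A - c + (g u - c) < d * N%:R.
    by rewrite mulrC -ltr_pdivrMr //; apply: le_lt_trans BN; rewrite /B; lra.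
  have Na : 1 < (1 - a) * N%:R.
    rewrite mulrC -ltr_pdivrMr // mul1r; apply: le_lt_trans BN.
    by rewrite /B; lra.
  have N1 : (3 < N)%N by move: N3; rewrite ltr_nat.
  have NK : N.-1%:R = N%:R - 1 :> R.
    by rewrite -[in RHS](ltn_predK N1) -natr1 addrK.
  have K0 : 0 < N.-1%:R :> R by rewrite NK; lra.
  (* [N - 1] replaces [N] because [polar_small] needs a strict inequality below [1 / k]. *)
  have [|||n1 /(_ g W A c 0 gn) small] := @polar_small N%:R^-1 N.-1.
  - by rewrite invr_gt0.
  - by rewrite -ltnS (ltn_predK N1) (ltn_trans _ N1).
  - by rewrite ltf_pV2 ?posrE // NK; lra.
  (* The successor makes [l / N] strictly larger than [a], as [polar_mono] requires. *)
  pose l := (Num.trunc (a * N%:R)).+1.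
  have l1 : a * N%:R < l%:R := truncnS_gt _.
  have l2 : l%:R <= a * N%:R + 1.
    by rewrite /l -natr1 lerD2r truncn_le mulr_ge0 // ltW.
  have lN : a < l%:R / N%:R by rewrite ltr_pdivlMr.
  have lN1 : l%:R / N%:R < 1 :> R by rewrite ltr_pdivrMr //; lra.
  have [n2 /(_ g W A c 0 gn) mono] := polar_mono a_gt0 lN lN1.
  have [|||v [v0 vl /andP[_ hi]]] :=
    @polar_chain g W A c 0 N%:R^-1 0 ((A - c) / N.-1%:R) gn _ _ l.
  - by rewrite invr_ge0 ltW.
  - move=> v v0 vx; have := small v v0; rewrite vx mulr0 addr0 => ->//.
    by have := polar_lower gW gA gp gc v0; rewrite subr0 subr_ge0 => ->.
  - exact: ltW.
  have := mono u v u0 v0 (lexx _); rewrite vl mulr0 addr0 => /(_ (lexx _)) uv.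
  have : (g u - c) * N.-1%:R <= l%:R * (A - c).
    by rewrite -ler_pdivlMr // -mulrA; lra.
  have : l%:R * (A - c) <= (a * N%:R + 1) * (A - c) by rewrite ler_wpM2r.
  have aC : a * (A - c) <= A - c by rewrite ler_piMl // ltW.
  rewrite NK; move: Nd; rewrite /d; lra.
have lower u : 0 < dot u u -> cosq u * (A - c) <= g u - c.
  move=> u0; have [t [d [[t0 d0 d2] [ut te ue tE]]]] := orthogonal_top u0.
  have := complement_top gW gc u0 t0 d0 d2 ut te ue.
  have := upper t t0; rewrite tE gpole.
  by rewrite mulrBl mul1r; lra.
by move=> u u0; have := upper u u0; have := lower u u0; lra.
Qed.

End Polar.
(** * Extrema of frame functions *)

Section Attained.
Variable R : realType.
Notation vec := (R * R * R)%type.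
Implicit Types (u v w : vec) (f g : vec -> R) (W A M m e x y z : R).

(** Inner products with [a], [b], [c] determine a vector: the square of the determinant [D] is the
    Gram determinant, here [1], and Cramer's rule applies. *)
Lemma lin3K (a b c : vec) u : orthonormal3 a b c ->
  lin3 a b c (dot u a, dot u b, dot u c) = u.
Proof.
move=> [[aa bb cc] [ab bc ac]].
pose D := a.1.1 * (b.1.2 * c.2 - b.2 * c.1.2) - a.1.2 * (b.1.1 * c.2 - b.2 * c.1.1)
  + a.2 * (b.1.1 * c.1.2 - b.1.2 * c.1.1).
have D1 : D * D = 1.
  transitivity (dot a a * (dot b b * dot c c - dot b c * dot b c)
    - dot a b * (dot a b * dot c c - dot b c * dot a c)
    + dot a c * (dot a b * dot b c - dot b b * dot a c)).
    by rewrite /D /dot; ring.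
  by rewrite aa bb cc ab bc ac; ring.
have D0 : D != 0 by apply: contra_eq_neq D1 => ->; rewrite mulr0 eq_sym oner_neq0.
pose v : vec := lin3 a b c (dot u a, dot u b, dot u c).
have va : dot v a = dot u a.
  transitivity (dot u a * dot a a + dot u b * dot a b + dot u c * dot a c).
    by rewrite /v /dot /=; ring.
  by rewrite aa ab ac; ring.
have vb : dot v b = dot u b.
  transitivity (dot u a * dot a b + dot u b * dot b b + dot u c * dot b c).
    by rewrite /v /dot /=; ring.
  by rewrite bb ab bc; ring.
have vc : dot v c = dot u c.
  transitivity (dot u a * dot a c + dot u b * dot b c + dot u c * dot c c).
    by rewrite /v /dot /=; ring.
  by rewrite cc ac bc; ring.
rewrite -/v; move: v va vb vc => [[v1 v2] v3] va vb vc.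
case: u va vb vc => -[u1 u2] u3 va vb vc.
pose da := dot (v1, v2, v3) a - dot (u1, u2, u3) a.
pose db := dot (v1, v2, v3) b - dot (u1, u2, u3) b.
pose dc := dot (v1, v2, v3) c - dot (u1, u2, u3) c.
have da0 : da = 0 by rewrite /da va subrr.
have db0 : db = 0 by rewrite /db vb subrr.
have dc0 : dc = 0 by rewrite /dc vc subrr.
congr (_, _, _); apply: (mulfI D0); apply/eqP; rewrite -subr_eq0; apply/eqP.
- transitivity (da * (b.1.2 * c.2 - b.2 * c.1.2)
   + db * (c.1.2 * a.2 - c.2 * a.1.2)
   + dc * (a.1.2 * b.2 - a.2 * b.1.2)).
    by rewrite /D /da /db /dc /dot /=; ring.
  by rewrite da0 db0 dc0; ring.
- transitivity (da * (b.2 * c.1.1 - b.1.1 * c.2)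
   + db * (c.2 * a.1.1 - c.1.1 * a.2)
   + dc * (a.2 * b.1.1 - a.1.1 * b.2)).
    by rewrite /D /da /db /dc /dot /=; ring.
  by rewrite da0 db0 dc0; ring.
- transitivity (da * (b.1.1 * c.1.2 - b.1.2 * c.1.1)
   + db * (c.1.1 * a.1.2 - c.1.2 * a.1.1)
   + dc * (a.1.1 * b.1.2 - a.1.2 * b.1.1)).
    by rewrite /D /da /db /dc /dot /=; ring.
  by rewrite da0 db0 dc0; ring.
Qed.

Definition bounded3 f m M := forall u, 0 < dot u u -> m <= f u <= M.

Definition quarter u : vec := (- u.1.2, u.1.1, u.2).

Lemma dot_quarter u v : dot (quarter u) (quarter v) = dot u v.
Proof. by rewrite /dot /=; ring. Qed.

Lemma frame_quarter f W : frame_function f W -> frame_function (f \o quarter) W.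
Proof.
move=> [fZ fW]; split=> [k u k0|u v w u0 v0 w0 uv vw uw] /=.
  by rewrite -[RHS](fZ k) //; congr f; rewrite /scale3 /quarter /= mulrN.
by apply: fW; rewrite dot_quarter.
Qed.

(** An equatorial [u], its quarter turn and the pole form a frame, so the sum is constant on the
    equator. *)
Lemma nearly_maximal_quarter f W M e : frame_function f W ->
  (forall u, 0 < dot u u -> f u <= M) -> 0 <= e -> M - e <= f (pole R) ->
  nearly_maximal (fun u => f u + f (quarter u))
    (W + W) (2 * M) (W - f (pole R)) (2 * e).
Proof.
move=> fW fM e0 fp; split; first exact: frameD fW (frame_quarter fW).
- move=> u u0; have := fM u u0; have := fM (quarter u).
  by rewrite dot_quarter => /(_ u0); lra.
- have -> : quarter (pole R) = pole R by rewrite /quarter /= oppr0.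
  lra.
- by rewrite mulr_ge0.
case=> -[x y] z u0 /= z0; case: fW => _ /(_ (x, y, z) (quarter (x, y, z)) (pole R)).
rewrite dot_quarter => /(_ u0 u0 (dot_pole R)) <-.
- by rewrite addrK.
- by rewrite /dot /= z0; ring.
- by rewrite /dot /= z0; ring.
- by rewrite /dot /= z0; ring.
Qed.

(** For [g = f + f \o quarter], the direction complementary to [u] is close to the equator, where
    [polar_small] keeps [g] close to its equatorial value. Hence [g u] is close to [2 * M], and
    [f (quarter u) <= M] leaves [f u] close to [M]. *)
Lemma near_pole (m M d : R) : 0 < d -> m <= M -> exists e x, [/\ 0 < e, 0 < x &
  forall f W, frame_function f W -> bounded3 f m M -> M - e <= f (pole R) ->
  forall u, 0 < dot u u -> 1 - x <= cosq u -> M - d <= f u].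
Proof.
move=> d0 mM; pose B := 3 * (M - m).
have B0 : 0 <= B by rewrite mulr_ge0 // subr_ge0.
pose k := (Num.trunc (4 * B / d)).+2.
have kB : B / k%:R <= d / 4.
  have k0 : 0 < k%:R :> R by rewrite ltr0n.
  have : 4 * B / d < k%:R by apply: lt_trans (truncnS_gt _) _; rewrite ltr_nat.
  by rewrite ltr_pdivrMr // ler_pdivrMr //; lra.
have k1 : (1 < k)%N by [].
have k0 : 0 < k%:R^-1 :> R by rewrite invr_gt0 ltr0n.
have [|//||n hn] := @polar_small R (k%:R^-1 / 2) k; rewrite ?divr_gt0 //; first lra.
(* The defect of [g] is [2 * e], counted [n + 1] times, which makes [d / 2]; the term [B / k] adds
   at most [d / 4]. *)
pose e := d / (4 * (n%:R + 1)).
have n0 : 0 < n%:R + 1 :> R by rewrite ltr_wpDl.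
have e0 : 0 < e by rewrite divr_gt0 // mulr_gt0.
exists e, (k%:R^-1 / 2); split=> //; first by rewrite divr_gt0.
move=> f W fW fb fp u u0 ux.
have fM v (v0 : 0 < dot v v) : f v <= M by have /andP[] := fb v v0.
have fm v (v0 : 0 < dot v v) : m <= f v by have /andP[] := fb v v0.
have gn := nearly_maximal_quarter fW fM (ltW e0) fp.
have [t [v [[t0 v0 v2] [ut tv uv tE]]]] := orthogonal_top u0.
have [gW gA gp _ gc] := gn.
have := complement_top gW gc u0 t0 v0 v2 ut tv uv.
have tx : cosq t <= k%:R^-1 / 2 by rewrite tE; lra.
have := hn _ _ _ _ _ gn t t0 tx.
have := fM (quarter u); rewrite dot_quarter => /(_ u0) fru.
have : (2 * M - (W - f (pole R))) / k%:R <= B / k%:R.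
  rewrite ler_wpM2r ?(ltW k0) // /B.
  have := fM _ (dot_pole R).
  case: fW => _ /(_ _ _ _ (dot_e1 R) (dot_e2 R) (dot_pole R)) <-.
  - have := fm _ (dot_e1 R); have := fm _ (dot_e2 R).
    by have := fm _ (dot_pole R); lra.
  1-3: by rewrite /dot /= !(mulr0, mul0r, addr0).
have : e * (n%:R + 1) = d / 4 by rewrite /e; field; rewrite gt_eqF.
move: kB gp; rewrite (_ : quarter (pole R) = pole R); last first.
  by rewrite /quarter /= oppr0.
lra.
Qed.

(** [near_pole] with [v] rotated to the pole. As [e] and [x] depend on neither [f] nor [v], this
    stands in for continuity near the supremum. *)
Lemma near_maximum (m M d : R) : 0 < d -> m <= M -> exists e x, [/\ 0 < e, 0 < x &
  forall f W, frame_function f W -> bounded3 f m M ->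
  forall u v, 0 < dot u u -> 0 < dot v v -> M - e <= f v ->
  (1 - x) * (dot u u * dot v v) <= dot u v ^+ 2 -> M - d <= f u].
Proof.
move=> d0 mM; have [e [x [e0 x0 H]]] := near_pole d0 mM.
exists e, x; split=> // f W fW fb u v u0 v0 fv uv.
have [a [b [c [k [oabc k0 vE]]]]] := orthonormal_complete v0.
have linp : lin3 a b c (pole R) = c.
  by rewrite /lin3 /= !mul0r !add0r !mul1r; case: (c) => -[].
pose w : vec := (dot u a, dot u b, dot u c).
have uE : lin3 a b c w = u by apply: lin3K.
have ww : dot w w = dot u u by rewrite -(dot_lin3 w w oabc) uE.
rewrite -uE; apply: (H (f \o lin3 a b c) W) => //=.
- exact: frame_lin3.
- by move=> y y0; apply: fb; rewrite dot_lin3.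
- by rewrite linp; case: fW => /(_ k c k0) <- _; rewrite -vE.
- by rewrite ww.
- rewrite /cosq ww ler_pdivlMr //.
  rewrite -(ler_pM2l (_ : 0 < k ^+ 2)) ?exprn_even_gt0 ?k0 //=.
  have -> : k ^+ 2 * dot u c ^+ 2 = dot u v ^+ 2 by rewrite vE /dot /=; ring.
  have -> : k ^+ 2 * ((1 - x) * dot u u) = (1 - x) * (dot u u * (k ^+ 2 * dot c c)).
    by case: (oabc) => -[_ _ ->] _; ring.
  by have -> : k ^+ 2 * dot c c = dot v v by rewrite vE /dot /=; ring.
Qed.

(** Compactness of the cube [[-1, 1]^3], stated with a cluster point instead of a subsequence. *)
Lemma unit_cluster (q : nat -> vec) : (forall n, dot (q n) (q n) = 1) ->
  exists p : vec, forall (r : R) N, 0 < r -> exists2 n, (N <= n)%N &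
    [/\ `|p.1.1 - (q n).1.1| < r, `|p.1.2 - (q n).1.2| < r & `|p.2 - (q n).2| < r].
Proof.
move=> q1; pose I : set R := `[-1, 1]%classic.
have cI : compact I by apply: segment_compact.
have sqle (x y z : R) : x * x + y * y + z * z = 1 -> I x.
  rewrite /I /= in_itv /= -ler_norml => E.
  rewrite -(@expr_le1 _ 2%N) // real_normK ?num_real //.
  by have := sqr_ge0 y; have := sqr_ge0 z; lra.
have qI n : (I `*` I `*` I)%classic (q n).
  have := q1 n; rewrite /dot => E; split; first split => /=.
  - exact: sqle E.
  - by apply: (sqle _ (q n).1.1 (q n).2); lra.
  - by apply: (sqle _ (q n).1.1 (q n).1.2); lra.
have FI : (\forall n \near \oo, (I `*` I `*` I) (q n))%classic.
  by near=> n; apply: qI.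
have cI3 := compact_setX (compact_setX cI cI) cI.
have [p [_ clp]] := cI3 _ (fmap_proper_filter q _) FI.
exists p => r N r0.
have [z [[n Nn <-] pz]] : ((q @` [set n | (N <= n)%N]) `&` ball p r !=set0)%classic.
  apply: clp; last exact: nbhsx_ballx.
  by apply: filterS (nbhs_infty_ge N) => n Nn; exists n.
by exists n => //; case: pz => -[].
Unshelve. all: by end_near.
Qed.

(** A cluster point [p] of a maximizing sequence is at a small angle from terms where [f] nearly
    equals its supremum, so [near_maximum] bounds [f p] below by [S - d] for every [d]. *)
Lemma maximum_attained f W m M : frame_function f W -> bounded3 f m M ->
  exists2 p, 0 < dot p p & forall u, 0 < dot u u -> f u <= f p.
Proof.
move=> fW fb; pose E : set R := [set f u | u in [set u | 0 < dot u u]]%classic.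
have hE : has_sup E.
  split; first by exists (f (pole R)); exists (pole R) => //; apply: dot_pole.
  by exists M => _ [u u0 <-]; have /andP[] := fb u u0.
pose S := sup E.
have fS u : 0 < dot u u -> f u <= S.
  by move=> u0; apply: sup_upper_bound => //; exists u.
have fbS : bounded3 f m S.
  by move=> u u0; rewrite fS // andbT; have /andP[] := fb u u0.
have mS : m <= S by have /andP[] := fbS _ (dot_pole R); apply: le_trans.
have adh n : exists q, dot q q = 1 /\ S - n.+1%:R^-1 <= f q.
  have [|_ [u u0 <-] Su] := @sup_adherent R E n.+1%:R^-1 _ hE.
    by rewrite invr_gt0.
  have [a [b [c [k [[[_ _ cc] _] k0 uE]]]]] := orthonormal_complete u0.
  exists c; split=> //; rewrite ltW //.
  by case: fW => /(_ k c k0) <- _; rewrite -uE.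
have [q qP] := choice adh.
have [p pP] := unit_cluster (fun n => (qP n).1).
have p_ge d : 0 < d -> 0 < dot p p /\ S - d <= f p.
  move=> d0; have [e [x [e0 x0 H]]] := near_maximum d0 mS.
  (* Gives [|p - u|^2 <= 3 * r ^+ 2 <= x / 4], while [dot p u ^+ 2 >= 1 / 4]; so the squared cosine
     of the angle is at least [1 - x]. *)
  pose r := Num.min 6^-1 (x / 2).
  have r0 : 0 < r by rewrite lt_min divr_gt0 // andbT invr_gt0.
  have r6 : r <= 6^-1 by rewrite ge_min lexx.
  have rx : r <= x / 2 by rewrite ge_min lexx orbT.
  have [n Nn] := pP r (Num.trunc e^-1) r0.
  have := qP n; move: (q n) => u [qq Sq] [h1 h2 h3].
  have en : n.+1%:R^-1 <= e.
    rewrite -[e]invrK lef_pV2 ?posrE ?invr_gt0 //.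
    by apply: le_trans (ltW (truncnS_gt _)) _; rewrite ler_nat ltnS.
  move: h1 h2 h3; rewrite !ltr_norml => /andP[h1 h1'] /andP[h2 h2'] /andP[h3 h3'].
  pose d1 := p.1.1 - u.1.1; pose d2 := p.1.2 - u.1.2; pose d3 := p.2 - u.2.
  have dd : d1 ^+ 2 + d2 ^+ 2 + d3 ^+ 2 <= 3 * r ^+ 2 by rewrite /d1 /d2 /d3; nra.
  pose s := d1 * u.1.1 + d2 * u.1.2 + d3 * u.2.
  have cs : s ^+ 2 <= d1 ^+ 2 + d2 ^+ 2 + d3 ^+ 2.
    rewrite -[leRHS]mulr1 -qq /s /dot -subr_ge0.
    rewrite [leRHS](_ : _ = (d1 * u.1.2 - d2 * u.1.1) ^+ 2
      + (d2 * u.2 - d3 * u.1.2) ^+ 2 + (d3 * u.1.1 - d1 * u.2) ^+ 2); last by ring.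
    by rewrite !addr_ge0 // sqr_ge0.
  have pu : dot p u = 1 + s by rewrite -qq /dot /s /d1 /d2 /d3; ring.
  have pp : dot p p = 1 + 2 * s + (d1 ^+ 2 + d2 ^+ 2 + d3 ^+ 2).
    by rewrite -{1}qq /dot /s /d1 /d2 /d3; ring.
  have r2 : 3 * r ^+ 2 <= x / 4 by nra.
  have r3 : 3 * r ^+ 2 <= 4^-1 by nra.
  have s3 : 4^-1 <= (1 + s) ^+ 2.
    have : `|s| <= 2^-1.
      rewrite -ler_sqr ?nnegrE ?normr_ge0 ?invr_ge0 //.
      by rewrite real_normK ?num_real //; lra.
    by rewrite ler_norml => /andP[s1 s2]; nra.
  have p0 : 0 < dot p p by rewrite pp; nra.
  split=> //; apply: (H f W fW fbS p u) => //; rewrite ?qq ?ltr01 //.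
    by apply: le_trans Sq; rewrite lerD2l lerN2.
  rewrite mulr1 pu pp -subr_ge0; nra.
have p0 : 0 < dot p p by have [] := p_ge 1 ltr01.
exists p => // u u0; apply: le_trans (fS u u0) _.
by apply/ler_addgt0Pr => d d0; have [_] := p_ge d d0; lra.
Qed.

End Attained.
(** * Gleason's theorem in three real dimensions *)

Section Gleason3.
Variable R : realType.
Notation vec := (R * R * R)%type.
Implicit Types (a b c u v w n : vec) (f g h : vec -> R) (W A M m e x y z : R).

Lemma lin3_pole a b c : lin3 a b c (pole R) = c.
Proof. by rewrite /lin3 /= !mul0r !add0r !mul1r; case: (c) => -[]. Qed.

Lemma orthonormal_lin3 a b c u v w : orthonormal3 a b c ->
  orthonormal3 u v w ->
  orthonormal3 (lin3 a b c u) (lin3 a b c v) (lin3 a b c w).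
Proof. by move=> o [[? ? ?] [? ? ?]]; split; split; rewrite dot_lin3. Qed.

(** At an exact maximum the defect is zero and [polar_exact] applies, with bound [2 * M] and
    equatorial value [W - M]. *)
Lemma maximum_quarter a b c f W M : orthonormal3 a b c -> frame_function f W ->
  (forall u, 0 < dot u u -> f u <= M) -> f c = M ->
  forall u, 0 < dot u u -> f (lin3 a b c u) + f (lin3 a b c (quarter u)) =
    W - M + cosq u * (3 * M - W).
Proof.
move=> oabc fW fM fc u u0; have gW := frame_lin3 oabc fW.
have gM v : 0 < dot v v -> (f \o lin3 a b c) v <= M.
  by move=> v0; apply: fM; rewrite dot_lin3.
have gp : M - 0 <= (f \o lin3 a b c) (pole R) by rewrite /= lin3_pole fc subr0.
have := nearly_maximal_quarter gW gM (lexx 0) gp.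
rewrite mulr0 /= lin3_pole fc => /polar_exact/(_ _ u0) ->.
by congr (_ + _ * _); ring.
Qed.

(** The minimum can be moved to a point orthogonal to the maximum [p]: if [e] is the projection of
    [r] onto the plane orthogonal to [p], and [t] the top of the plane orthogonal to [r], then
    [f r + f t = f e + f p] and [f t <= f p], whence [f e <= f r]. *)
Lemma extremal_frame f W m M : frame_function f W -> bounded3 f m M ->
  exists a b c, orthonormal3 a b c /\
    forall u, 0 < dot u u -> f c <= f u <= f a.
Proof.
move=> fW fb; have [p p0 fp] := maximum_attained fW fb.
have fNb : bounded3 (fun u => - f u) (- M) (- m).
  by move=> u u0; rewrite !lerN2 andbC fb.
have [r r0 fr] := maximum_attained (frameN fW) fNb.
have {}fr u : 0 < dot u u -> f r <= f u by move=> /fr; rewrite lerN2.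
have [a [b [c [k [oabc k0 pE]]]]] := orthonormal_complete p0.
have fc : f c = f p by case: fW => /(_ k c k0) <- _; rewrite -pE.
have [x [y [xy1 fxy]]] : exists x y, x ^+ 2 + y ^+ 2 = 1 /\
    f (lin3 a b c (x, y, 0)) <= f r.
  pose s : vec := (dot r a, dot r b, dot r c).
  have sE : lin3 a b c s = r by apply: lin3K.
  have ss : 0 < dot s s by rewrite -(dot_lin3 s s oabc) sE.
  move: s sE ss => [[x y] z] sE ss.
  (* If [r] is parallel to [p], the minimum equals the maximum and any direction orthogonal to [p]
     serves. *)
  have [xy0|xy0] := eqVneq (x ^+ 2 + y ^+ 2) 0.
    have /andP[/eqP x0 /eqP y0] : (x == 0) && (y == 0).
      by move/eqP: xy0; rewrite paddr_eq0 ?sqr_ge0 // !sqrf_eq0.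
    exists 1, 0; split; first by rewrite expr1n expr0n addr0.
    apply: le_trans (fp _ _) _; first by rewrite dot_lin3 ?dot_e1.
    rewrite -fc -sE x0 y0.
    have z0 : z != 0.
      by apply: contraTneq ss => ->; rewrite x0 y0 /dot /= !mulr0 !addr0 ltxx.
    case: fW => /(_ z c z0) <- _.
    rewrite le_eqVlt; apply/orP; left; apply/eqP; congr f.
    by rewrite /lin3 /scale3 /=; congr (_, _, _); ring.
  have xy_gt0 : 0 < x ^+ 2 + y ^+ 2.
    by rewrite lt_neqAle eq_sym xy0 addr_ge0 ?sqr_ge0.
  pose N := Num.sqrt (x ^+ 2 + y ^+ 2).
  have N0 : N != 0 by rewrite gt_eqF // sqrtr_gt0.
  have NE : N ^+ 2 = x ^+ 2 + y ^+ 2 by rewrite sqr_sqrtr // ltW.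
  exists (x / N), (y / N); split.
    by rewrite !expr_div_n -mulrDl -NE divff // expf_neq0.
  have [gZ gW] := frame_lin3 oabc fW.
  have -> : f (lin3 a b c (x / N, y / N, 0)) = f (lin3 a b c (x, y, 0)).
    rewrite -[LHS](gZ N) //=; congr (f (lin3 _ _ _ _)).
    by rewrite /scale3 /= mulr0; congr (_, _, _); field.
  pose t : vec := (- x * z, - y * z, x ^+ 2 + y ^+ 2).
  pose d : vec := (- y, x, 0); pose e : vec := (x, y, 0).
  have d0 : 0 < dot d d by rewrite /dot /= mulrNN mulr0 addr0 -!expr2 addrC.
  have e0 : 0 < dot e e by rewrite /dot /= mulr0 addr0 -!expr2.
  have t0 : 0 < dot t t.
    have -> : dot t t = (x ^+ 2 + y ^+ 2) * dot (x, y, z) (x, y, z).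
      by rewrite /t /dot /=; ring.
    by rewrite mulr_gt0.
  have := gW _ _ _ ss t0 d0; have := gW _ _ _ e0 (dot_pole R) d0.
  rewrite /= sE lin3_pole fc => H1 H2.
  have {}H1 := H1 _ _ _; have {}H2 := H2 _ _ _.
  have := fp (lin3 a b c t); rewrite dot_lin3 // => /(_ t0).
  have : f (lin3 a b c e) + f p + f (lin3 a b c d) = W.
    by apply: H1; rewrite /dot /=; ring.
  have : f r + f (lin3 a b c t) + f (lin3 a b c d) = W.
    by apply: H2; rewrite /dot /=; ring.
  lra.
exists c, (lin3 a b c (- y, x, 0)), (lin3 a b c (x, y, 0)); split.
  rewrite -{1}(lin3_pole a b c); apply: orthonormal_lin3 oabc _.
  by split; split; rewrite /dot /=; lra.
move=> u u0; rewrite fc fp // andbT; exact: le_trans fxy (fr u u0).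
Qed.

(* [h] changes sign under each transposition of coordinates, hence vanishes on
   the six planes [u_i = +- u_j].  At a maximum [c] of [h] this forces
   [dot n c ^+ 2 >= 1] for each of the six normals [n], which contradicts
   the fact that the sum of these squares is [4]. *)
Lemma antisymmetric_le0 h m M : frame_function h 0 -> bounded3 h m M ->
  (forall x y z, 0 < dot (x, y, z) (x, y, z) -> h (- y, x, z) = - h (x, y, z)) ->
  (forall x y z, 0 < dot (x, y, z) (x, y, z) -> h (x, - z, y) = - h (x, y, z)) ->
  forall u, 0 < dot u u -> h u <= 0.
Proof.
move=> hW hb h12 h23.
have hN x y z : h (- x, - y, - z) = h (x, y, z).
  case: hW => /(_ (-1) (x, y, z)); rewrite oppr_eq0 oner_neq0 => /(_ isT) <- _.
  by rewrite /scale3 /= !mulN1r.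
(* Quarter turns applied twice give invariance under sign changes, modulo which a quarter turn is a
   transposition. *)
have hNN x y z : 0 < dot (x, y, z) (x, y, z) -> h (- x, - y, z) = h (x, y, z).
  move=> u0; rewrite h12 ?h12 ?opprK // /dot /=; move: u0; rewrite /dot /=; lra.
have hN3 x y z : 0 < dot (x, y, z) (x, y, z) -> h (x, y, - z) = h (x, y, z).
  by move=> u0; have := hN x y (- z); rewrite opprK => <-; apply: hNN.
have hN23 x y z : 0 < dot (x, y, z) (x, y, z) -> h (x, - y, - z) = h (x, y, z).
  move=> u0; rewrite h23 ?h23 ?opprK // /dot /=; move: u0; rewrite /dot /=; lra.
have hN1 x y z : 0 < dot (x, y, z) (x, y, z) -> h (- x, y, z) = h (x, y, z).
  by move=> u0; have := hN x (- y) (- z); rewrite !opprK => ->; apply: hN23.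
have hN2 x y z : 0 < dot (x, y, z) (x, y, z) -> h (x, - y, z) = h (x, y, z).
  move=> u0; have <- := hN1 x (- y) z; first exact: hNN.
  by move: u0; rewrite /dot /=; lra.
have s12 x y z : 0 < dot (x, y, z) (x, y, z) -> h (y, x, z) = - h (x, y, z).
  move=> u0; rewrite -h12 //; apply/esym/hN1.
  by move: u0; rewrite /dot /=; lra.
have s23 x y z : 0 < dot (x, y, z) (x, y, z) -> h (x, z, y) = - h (x, y, z).
  move=> u0; rewrite -h23 //; apply/esym/hN2.
  by move: u0; rewrite /dot /=; lra.
have z12 x z : 0 < dot (x, x, z) (x, x, z) -> h (x, x, z) = 0.
  by move=> u0; have := s12 _ _ _ u0; lra.
have z23 x z : 0 < dot (z, x, x) (z, x, x) -> h (z, x, x) = 0.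
  by move=> u0; have := s23 _ _ _ u0; lra.
have z13 x y : 0 < dot (x, y, x) (x, y, x) -> h (x, y, x) = 0.
  move=> u0; have := s12 _ _ _ u0; rewrite z23; first lra.
  by move: u0; rewrite /dot /=; lra.
have [p p0 hp] := maximum_attained hW hb.
have [a [b [c [k [oabc k0 pE]]]]] := orthonormal_complete p0.
have hc : h c = h p by case: hW => /(_ k c k0) <- _; rewrite -pE.
move=> u /hp /le_trans; apply; rewrite leNgt; apply/negP => hp0.
have normal n : dot n n = 2 ->
  (forall u, 0 < dot u u -> dot u n = 0 -> h u = 0) -> 1 <= dot n c ^+ 2.
  move=> n2 hn.
  have nE := lin3K n oabc.
  have : dot (dot n a, dot n b, dot n c) (dot n a, dot n b, dot n c) = 2.
    by rewrite -(dot_lin3 _ _ oabc) nE.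
  rewrite /dot /= -!/(dot _ _).
  set n1 := dot n a in nE *; set nb := dot n b in nE *; set n3 := dot n c in nE *.
  move=> N2.
  have [s0|s0] := eqVneq (n1 * n1 + nb * nb) 0.
    by move: N2; rewrite expr2; lra.
  have {s0}s_gt0 : 0 < n1 * n1 + nb * nb.
    by rewrite lt_neqAle eq_sym s0 addr_ge0 // -expr2 sqr_ge0.
  (* Both [t] and its quarter turn about [c] are orthogonal to [n], so [h] vanishes at both, and
     [maximum_quarter] forces [cosq t = 1 / 3], that is [n3 ^+ 2 = 1]. *)
  pose t : vec := (n3 * (n1 + nb), n3 * (nb - n1), - (n1 * n1 + nb * nb)).
  have t0 : 0 < dot t t.
    have -> : dot t t =
      (n1 * n1 + nb * nb) * (2 * n3 ^+ 2 + (n1 * n1 + nb * nb)).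
      by rewrite /dot /t /=; ring.
    by rewrite mulr_gt0 // ltr_wpDl // mulr_ge0 ?sqr_ge0.
  have H v : 0 < dot v v -> dot v (n1, nb, n3) = 0 -> h (lin3 a b c v) = 0.
    by move=> v0 vn; apply: hn; [rewrite dot_lin3|rewrite -nE dot_lin3].
  have := maximum_quarter oabc hW hp hc t0.
  rewrite !H ?dot_quarter //; last 2 first.
  - by rewrite /dot /quarter /t /=; ring.
  - by rewrite /dot /t /=; ring.
  move=> E; have : 3 * t.2 ^+ 2 = dot t t.
    have t3 : cosq t * 3 = 1 by apply: (mulIf (lt0r_neq0 hp0)); lra.
    by transitivity (cosq t * 3 * dot t t);
      [rewrite /cosq; field; rewrite gt_eqF|rewrite t3 mul1r].
  have -> : dot t t =
      (n1 * n1 + nb * nb) * (2 * n3 ^+ 2 + (n1 * n1 + nb * nb)).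
    by rewrite /dot /t /=; ring.
  rewrite /t /= sqrrN => E3.
  have : (n1 * n1 + nb * nb) * (n3 ^+ 2) =
      (n1 * n1 + nb * nb) * (n1 * n1 + nb * nb).
    by lra.
  by move=> /(mulfI (lt0r_neq0 s_gt0)); lra.
have cc : dot c c = 1 by case: oabc => -[].
have q12 := normal (1, -1, 0); have q12' := normal (1, 1, 0).
have q23 := normal (0, 1, -1); have q23' := normal (0, 1, 1).
have q13 := normal (1, 0, -1); have q13' := normal (1, 0, 1).
have : 1 <= dot (1, -1, 0) c ^+ 2.
  apply: q12; first by rewrite /dot /=; ring.
  move=> [[x y] z] u0 E; have xy : x = y by move: E; rewrite /dot /=; lra.
  by rewrite xy in u0 *; rewrite z12.
have : 1 <= dot (1, 1, 0) c ^+ 2.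
  apply: q12'; first by rewrite /dot /=; ring.
  move=> [[x y] z] u0 E; have xy : x = - y by move: E; rewrite /dot /=; lra.
  rewrite xy hN1 ?z12 //; move: u0; rewrite xy /dot /=; lra.
have : 1 <= dot (0, 1, -1) c ^+ 2.
  apply: q23; first by rewrite /dot /=; ring.
  move=> [[x y] z] u0 E; have xy : y = z by move: E; rewrite /dot /=; lra.
  by rewrite xy in u0 *; rewrite z23.
have : 1 <= dot (0, 1, 1) c ^+ 2.
  apply: q23'; first by rewrite /dot /=; ring.
  move=> [[x y] z] u0 E; have xy : y = - z by move: E; rewrite /dot /=; lra.
  rewrite xy hN2 ?z23 //; move: u0; rewrite xy /dot /=; lra.
have : 1 <= dot (1, 0, -1) c ^+ 2.
  apply: q13; first by rewrite /dot /=; ring.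
  move=> [[x y] z] u0 E; have xy : x = z by move: E; rewrite /dot /=; lra.
  by rewrite xy in u0 *; rewrite z13.
have : 1 <= dot (1, 0, 1) c ^+ 2.
  apply: q13'; first by rewrite /dot /=; ring.
  move=> [[x y] z] u0 E; have xy : x = - z by move: E; rewrite /dot /=; lra.
  rewrite xy hN1 ?z13 //; move: u0; rewrite xy /dot /=; lra.
move: cc; rewrite /dot /=; lra.
Qed.

Lemma parseval3 u v w n : 0 < dot u u -> 0 < dot v v -> 0 < dot w w ->
  dot u v = 0 -> dot v w = 0 -> dot u w = 0 ->
  dot n u ^+ 2 / dot u u + dot n v ^+ 2 / dot v v + dot n w ^+ 2 / dot w w
    = dot n n.
Proof.
move=> u0 v0 w0 uv vw uw.
pose k (t : vec) := (Num.sqrt (dot t t))^-1.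
have kE (t : vec) : 0 < dot t t -> k t ^+ 2 = (dot t t)^-1.
  by move=> t0; rewrite exprVn sqr_sqrtr // ltW.
have kk (t s : vec) : dot (scale3 (k t) t) (scale3 (k s) s) = k t * k s * dot t s.
  by rewrite /dot /=; ring.
have xk (t : vec) : dot n (scale3 (k t) t) = k t * dot n t by rewrite /dot /=; ring.
have o : orthonormal3 (scale3 (k u) u) (scale3 (k v) v) (scale3 (k w) w).
  by split; split; rewrite kk ?uv ?vw ?uw ?mulr0 // -expr2 kE // mulVf // gt_eqF.
rewrite -[in RHS](lin3K n o) dot_lin3 // !xk -!kE // [RHS]/dot /=.
ring.
Qed.

(** The quadratic form [q] has the extremal frame as axes and the values of [f] there as
    eigenvalues. [maximum_quarter], applied to [f] at [a] and to [- f] at [c], makes [h = f - q]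
    change sign under the quarter turns about these two axes. *)
Lemma gleason3 f W m M : frame_function f W -> bounded3 f m M ->
  exists a b c x y z, orthonormal3 a b c /\ forall u, 0 < dot u u ->
    f u * dot u u = x * dot u a ^+ 2 + y * dot u b ^+ 2 + z * dot u c ^+ 2.
Proof.
move=> fW fb; have [a [b [c [oabc fac]]]] := extremal_frame fW fb.
exists a, b, c, (f a), (f b), (f c); split=> // u u0.
have obca : orthonormal3 b c a.
  by case: oabc => -[aa bb cc] [ab bc ac]; split; split=> //; rewrite dotC.
have [[aa bb cc] [ab bc ac]] := oabc.
have Wabc : f a + f b + f c = W by case: fW => _; apply=> //; rewrite ?aa ?bb ?cc.
pose q u := (f a * u.1.1 ^+ 2 + f b * u.1.2 ^+ 2 + f c * u.2 ^+ 2) / dot u u.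
pose h u := f (lin3 a b c u) - q u.
suff h0 v : 0 < dot v v -> h v = 0.
  pose v : vec := (dot u a, dot u b, dot u c).
  have vE : lin3 a b c v = u by apply: lin3K.
  have vv : dot v v = dot u u by rewrite -(dot_lin3 _ _ oabc) vE.
  have : h v = 0 by apply: h0; rewrite vv.
  by rewrite /h vE /q vv => /subr0_eq ->; rewrite divfK // gt_eqF.
have qW : frame_function q W.
  split=> [k [[x y] z] k0|u1 v1 w1 u10 v10 w10 uv vw uw].
    (* At the zero vector both sides are [0], by the convention for division by zero. *)
    have [d0|d0] := eqVneq (dot (x, y, z) (x, y, z)) 0.
      rewrite /q d0 (_ : dot _ _ = k ^+ 2 * dot (x, y, z) (x, y, z)); last first.
        by rewrite /dot /=; ring.
      by rewrite d0 mulr0 invr0 !mulr0.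
    rewrite /q (_ : dot (scale3 _ _) _ =
      k ^+ 2 * dot (x, y, z) (x, y, z)); last first.
      by rewrite /dot /=; ring.
    by move: d0; rewrite /=; move: (dot _ _) => d d0; field; rewrite d0.
  have := parseval3 (1, 0, 0) u10 v10 w10 uv vw uw.
  have := parseval3 (0, 1, 0) u10 v10 w10 uv vw uw.
  have := parseval3 (0, 0, 1) u10 v10 w10 uv vw uw.
  have e1 t : dot (1, 0, 0) t = t.1.1 by rewrite /dot /=; ring.
  have e2 t : dot (0, 1, 0) t = t.1.2 by rewrite /dot /=; ring.
  have e3 t : dot (0, 0, 1) t = t.2 by rewrite /dot /=; ring.
  rewrite !e1 !e2 !e3 /= => E3 E2 E1; rewrite -Wabc -[f a in RHS]mulr1.
  rewrite -[f b in RHS]mulr1 -[f c in RHS]mulr1 -[X in f a * X]E1.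
  by rewrite -[X in f b * X]E2 -[X in f c * X]E3 /q; ring.
have hW : frame_function h 0.
  by rewrite -(subrr W); exact: frameD (frame_lin3 oabc fW) (frameN qW).
pose K := `|f a| + `|f b| + `|f c|.
have hb : bounded3 h (- (2 * K)) (2 * K).
  case=> -[x y] z v0; rewrite /h.
  have lin0 : 0 < dot (lin3 a b c (x, y, z)) (lin3 a b c (x, y, z)).
    by rewrite dot_lin3.
  have /andP[f1 f2] := fac _ lin0.
  have qK : `|q (x, y, z)| <= K.
    rewrite /q normrM normfV (gtr0_norm v0) ler_pdivrMr //=.
    apply: le_trans (ler_normD _ _) _.
    apply: le_trans (lerD (ler_normD _ _) (lexx _)) _.
    rewrite [ `|f a * _|]normrM [ `|f b * _|]normrM [ `|f c * _|]normrM.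
    rewrite ![ `|_ ^+ 2|]ger0_norm ?sqr_ge0 // /K /dot /=.
    have := normr_ge0 (f a); have := normr_ge0 (f b); have := normr_ge0 (f c).
    move: `|f a| `|f b| `|f c| => A B C C0 B0 A0.
    have := sqr_ge0 x; have := sqr_ge0 y; have := sqr_ge0 z.
    rewrite -!expr2 => z2 y2 x2.
    rewrite -subr_ge0 (_ : _ - _ = A * y ^+ 2 + A * z ^+ 2
      + (B * x ^+ 2 + B * z ^+ 2) + (C * x ^+ 2 + C * y ^+ 2)); last by ring.
    by rewrite !addr_ge0 //; exact: mulr_ge0.
  move: qK; rewrite ler_norml => /andP[q1 q2].
  have := ler_norm (f a); have := ler_norm (- f c); rewrite normrN.
  have := normr_ge0 (f a); have := normr_ge0 (f b); have := normr_ge0 (f c).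
  by rewrite /K in q1 q2 *; move=> *; apply/andP; split; lra.
have fNc u1 : 0 < dot u1 u1 -> - f u1 <= - f c.
  by move=> /fac /andP[+ _]; rewrite lerN2.
have fa u1 : 0 < dot u1 u1 -> f u1 <= f a by move=> /fac /andP[].
have h12 x y z : 0 < dot (x, y, z) (x, y, z) -> h (- y, x, z) = - h (x, y, z).
  move=> v0; have := maximum_quarter oabc (frameN fW) fNc erefl v0.
  rewrite /h /q /cosq (_ : dot (- y, x, z) _ = dot (x, y, z) (x, y, z)); last first.
    by rewrite /dot /=; ring.
  rewrite /quarter /= -Wabc => E; apply/eqP; rewrite -subr_eq0 opprK; apply/eqP.
  have dE : x ^+ 2 + y ^+ 2 = dot (x, y, z) (x, y, z) - z ^+ 2.
    by rewrite /dot /=; ring.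
  transitivity (- ((- f a - f b - f c) + f c + z ^+ 2 / dot (x, y, z) (x, y, z)
      * (3 * - f c + (f a + f b + f c)))
    - ((f a + f b) * (x ^+ 2 + y ^+ 2) + 2 * f c * z ^+ 2)
      / dot (x, y, z) (x, y, z)); first by lra.
  by rewrite dE; field; rewrite gt_eqF.
have h23 x y z : 0 < dot (x, y, z) (x, y, z) -> h (x, - z, y) = - h (x, y, z).
  move=> v0; have v0' : 0 < dot (y, z, x) (y, z, x).
    by move: v0; rewrite /dot /=; lra.
  have := maximum_quarter obca fW fa erefl v0'.
  rewrite /h /q /cosq (_ : dot (x, - z, y) _ = dot (x, y, z) (x, y, z)); last first.
    by rewrite /dot /=; ring.
  rewrite (_ : dot (y, z, x) _ = dot (x, y, z) (x, y, z)); last first.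
    by rewrite /dot /=; ring.
  have -> : lin3 b c a (y, z, x) = lin3 a b c (x, y, z).
    by rewrite /lin3 /=; congr (_, _, _); ring.
  have -> : lin3 b c a (quarter (y, z, x)) = lin3 a b c (x, - z, y).
    by rewrite /lin3 /=; congr (_, _, _); ring.
  rewrite /= -Wabc => E; apply/eqP; rewrite -subr_eq0 opprK; apply/eqP.
  have dE : y ^+ 2 + z ^+ 2 = dot (x, y, z) (x, y, z) - x ^+ 2.
    by rewrite /dot /=; ring.
  transitivity ((f a + f b + f c) - f a + x ^+ 2 / dot (x, y, z) (x, y, z)
      * (3 * f a - (f a + f b + f c))
    - ((f b + f c) * (y ^+ 2 + z ^+ 2) + 2 * f a * x ^+ 2)
      / dot (x, y, z) (x, y, z)); first by lra.
  by rewrite dE; field; rewrite gt_eqF.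
(* The same bound at the quarter turn of [v], where [h] takes the opposite value, gives
   [0 <= h v]. *)
case: v => -[x y] z v0; apply/le_anti.
have le0 := antisymmetric_le0 hW hb h12 h23.
rewrite le0 //= -oppr_le0 -h12 //; apply: le0.
by move: v0; rewrite /dot /=; lra.
Qed.

End Gleason3.
(** * Rank-one projections and orthogonal bases *)

Section Projections.
Variables (R : realType) (V : vectType R[i]) (ip : {dot V for conjC}).
Implicit Types (A B P Q U : 'End(V)) (x y z : V) (k : R[i]) (s t : seq V).
Implicit Types (M N : {fset 'End(V)}).

Lemma ipC x y : ip x y = (ip y x)^*.
Proof. by rewrite (hermC ip) expr0 mul1r. Qed.

Lemma ipDl x y z : ip (x + y) z = ip x z + ip y z.
Proof. exact: linearDl. Qed.

Lemma ipDr x y z : ip x (y + z) = ip x y + ip x z.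
Proof. exact: linearDr. Qed.

Lemma ipZl k x y : ip (k *: x) y = k * ip x y.
Proof. by rewrite linearZl_LR. Qed.

Lemma ipZr k x y : ip x (k *: y) = k^* * ip x y.
Proof. by rewrite linearZr_LR. Qed.

Lemma ip_eq0C x y : ip x y = 0 -> ip y x = 0.
Proof. by move=> xy; rewrite ipC xy rmorph0. Qed.

Definition proj x : 'End(V) := linfun (fun y => (ip y x / ip x x) *: x).

Lemma projE x y : proj x y = (ip y x / ip x x) *: x.
Proof.
have lin : linear (fun y => (ip y x / ip x x) *: x).
  by move=> k u v; rewrite linearPl /= mulrDl scalerDl scalerA mulrA.
pose f : {linear V -> V} := HB.pack (fun y => (ip y x / ip x x) *: x)
  (GRing.isLinear.Build _ _ _ _ _ lin).
exact: (lfunE f y).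
Qed.

Lemma proj_id x : proj x x = x.
Proof.
have [->|x0] := eqVneq x 0; first by rewrite linear0.
by rewrite projE divff ?scale1r // dnorm_eq0.
Qed.

Lemma proj_orth x y : ip y x = 0 -> proj x y = 0.
Proof. by move=> yx; rewrite projE yx mul0r scale0r. Qed.

Lemma projZ k x : k != 0 -> proj (k *: x) = proj x.
Proof.
move=> k0; apply/lfunP => y; rewrite !projE !ipZl !ipZr scalerA.
have [->|x0] := eqVneq x 0; first by rewrite !scaler0.
have xx : ip x x != 0 by rewrite dnorm_eq0.
by congr (_ *: _); field; rewrite xx k0 conjC_eq0 k0.
Qed.

Lemma proj_self_adjoint x y z : ip (proj x y) z = ip y (proj x z).
Proof.
rewrite !projE ipZl ipZr rmorphM /= fmorphV /= -!ipC.
by ring.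
Qed.

Lemma orthogonal_projection_proj x : orthogonal_projection ip (proj x).
Proof.
split.
  by apply/lfunP => y; rewrite comp_lfunE [proj x y]projE linearZ /= proj_id.
apply/lfunP => y; apply: (@ip_inj _ _ ip) => z.
by rewrite -adjointP proj_self_adjoint.
Qed.

Lemma limg_proj x : limg (proj x) = <[x]>%VS.
Proof.
apply/eqP; rewrite eqEsubv; apply/andP; split.
  by apply/subvP => _ /memv_imgP[y _ ->]; rewrite projE memvZ // memv_line.
by rewrite -memvE -{1}(proj_id x) memv_img ?memvf.
Qed.

Lemma proj_neq0 x : x != 0 -> proj x != 0.
Proof.
by apply: contraNneq => p0; rewrite -(proj_id x) p0 lfunE.
Qed.

Lemma proj_inj x y : x != 0 -> proj x = proj y -> exists2 k, k != 0 & y = k *: x.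
Proof.
move=> x0 xy; have : x \in <[y]>%VS by rewrite -limg_proj -xy limg_proj memv_line.
case/vlineP => k xE; have k0 : k != 0.
  by apply: contraNneq x0 => k0; rewrite xE k0 scale0r.
by exists k^-1; rewrite ?invr_eq0 // xE scalerA mulVf // scale1r.
Qed.

Lemma proj_comp_orth x y : ip x y = 0 -> (proj x \o proj y)%VF = 0.
Proof.
move=> xy; apply/lfunP => z; rewrite comp_lfunE [proj y z]projE linearZ /=.
by rewrite proj_orth ?scaler0 ?lfunE // ip_eq0C.
Qed.

Lemma proj_comp_eq0 x y : (proj x \o proj y)%VF = 0 -> ip x y = 0.
Proof.
move/lfunP/(_ y); rewrite !lfunE /= proj_id projE => /eqP.
rewrite scaler_eq0 mulf_eq0 invr_eq0 dnorm_eq0 => /orP[/orP[]|] /eqP.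
- exact: ip_eq0C.
- by move=> ->; rewrite linear0l.
- by move=> ->; rewrite linear0l.
Qed.

Lemma rank_one_proj P : orthogonal_projection ip P -> \dim (limg P) = 1%N ->
  exists2 x, x != 0 & P = proj x.
Proof.
move=> [PP Padj] dP.
have : limg P != 0%VS by rewrite -dimv_eq0 dP.
rewrite -vpick0; set x := vpick _ => x0.
have xP : x \in limg P by apply: memv_pick.
have Px : P x = x by case/memv_imgP: xP => y _ ->; rewrite -comp_lfunE PP.
have lP : limg P = <[x]>%VS.
  by apply/eqP; rewrite eq_sym eqEdim -memvE xP dP dim_vline x0.
exists x => //; apply/lfunP => y.
have : P y \in <[x]>%VS by rewrite -lP memv_img ?memvf.
case/vlineP => k Pyk; rewrite projE Pyk; congr (_ *: _).
have : ip (P y) x = ip y x by rewrite adjointP Padj Px.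
by rewrite Pyk ipZl => <-; rewrite mulfK // dnorm_eq0.
Qed.

Lemma comp_lfun_sumr (I : Type) (r : seq I) A (F : I -> 'End(V)) :
  (A \o \sum_(i <- r) F i)%VF = \sum_(i <- r) (A \o F i)%VF.
Proof.
elim: r => [|i r IH]; last by rewrite !big_cons comp_lfunDr IH.
by rewrite !big_nil comp_lfun0r.
Qed.

Lemma lftraceD A B : lftrace (A + B) = lftrace A + lftrace B.
Proof. by rewrite -big_split; apply: eq_bigr => i _; rewrite lfunE /= linearD. Qed.

Lemma lftrace_sum (I : Type) (r : seq I) (F : I -> 'End(V)) :
  lftrace (\sum_(i <- r) F i) = \sum_(i <- r) lftrace (F i).
Proof.
elim: r => [|i r IH]; last by rewrite !big_cons lftraceD IH.
by rewrite !big_nil /lftrace big1 // => i _; rewrite lfunE linear0.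
Qed.

Lemma lftrace_proj A x : lftrace (A \o proj x)%VF = ip (A x) x / ip x x.
Proof.
rewrite /lftrace.
transitivity (\sum_(i < \dim {:V})
  ip (coord (vbasis {:V}) i (A x) *: (vbasis {:V})`_i) x / ip x x).
  apply: eq_bigr => i _; rewrite comp_lfunE projE !linearZ /= ipZl.
  by rewrite mulrC mulrA.
rewrite -mulr_suml -linear_sumlz /=; congr (ip _ _ / _).
by rewrite -(coord_vbasis (memvf (A x))).
Qed.

Lemma lftrace1 : lftrace (\1%VF : 'End(V)) = (\dim {:V})%:R.
Proof.
rewrite /lftrace (eq_bigr (fun=> 1)) ?sumr_const ?card_ord // => i _.
by rewrite lfunE /= coord_free ?eqxx ?(basis_free (vbasisP _)).
Qed.

(** * Orthogonal bases and the measurements they define *)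

Lemma pairwise_orthogonal_head x s : pairwise_orthogonal ip (x :: s) ->
  x != 0 /\ {in s, forall y, ip y x = 0}.
Proof.
move=> /pairwise_orthogonalP[/= /andP[]].
rewrite inE negb_or eq_sym => /andP[x0 _] /andP[xs _] os; split=> // y ys.
apply: os; rewrite ?inE ?ys ?eqxx ?orbT //.
by apply: contraNneq xs => <-.
Qed.

(** The vectors are not normalized, and completeness is expressed by projections, as in
    [projective_measurement]. *)
Definition orthobasis s := pairwise_orthogonal ip s /\ \sum_(x <- s) proj x = \1%VF.

(** Take traces in the resolution of the identity: each projection contributes [1]. *)
Lemma orthobasis_size s : orthobasis s -> size s = \dim {:V}.
Proof.
move=> [/pairwise_orthogonalP[/= /andP[s0 _] _] s1]; apply/eqP.
rewrite -(eqr_nat R[i]) -lftrace1 -s1 lftrace_sum.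
rewrite (eq_big_seq (fun=> 1)) ?big_const_seq ?count_predT ?iter_addr_0 // => x xs.
rewrite -(comp_lfun1l (proj x)) lftrace_proj lfunE /= divff // dnorm_eq0.
by apply: contraNneq s0 => <-.
Qed.

(** As long as the projections do not sum to the identity, some vector has a nonzero Gram-Schmidt
    residue [r], which can be added to [s]. *)
Lemma orthobasis_extend s : pairwise_orthogonal ip s ->
  exists t, orthobasis (t ++ s).
Proof.
have [n] := ubnP (\dim {:V} - size s); elim: n s => // n IH s ltn os.
have [s1|s1] := eqVneq (\sum_(x <- s) proj x) \1%VF; first by exists [::].
have [y /eqP y0] : exists y, y - \sum_(x <- s) proj x y <> 0.
  apply: contrapT => h; move/negP: s1; apply; apply/eqP/lfunP => y.
  rewrite sum_lfunE lfunE /=; apply/eqP; rewrite eq_sym -subr_eq0; apply/eqP.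
  by apply: contrapT => y0; apply: h; exists y.
set r := y - _ in y0.
have [us oss] := pairwise_orthogonalP os.
have or x : x \in s -> ip r x = 0.
  move=> xs; rewrite linearBl /= linear_sumlz /= (bigD1_seq x) //=; last first.
    by case/andP: us.
  rewrite big1_seq ?addr0 => [|z /andP[zx zs]].
    by rewrite proj_self_adjoint proj_id subrr.
  by rewrite proj_self_adjoint proj_orth ?linear0r // oss // eq_sym.
have ors : pairwise_orthogonal ip (r :: s).
  apply/pairwise_orthogonalP; split.
    rewrite /= inE eq_sym negb_or y0 -andbA -[_ && uniq s]/(_ && _).
    move: us => /= /andP[-> ->]; rewrite andbT /=.
    by apply: contraNN y0 => rs; rewrite -(dnorm_eq0 ip) or.
  move=> u v; rewrite !inE => /predU1P[->|us'] /predU1P[->|vs'] uv.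
  - by rewrite eqxx in uv.
  - exact: or.
  - by apply: ip_eq0C; apply: or.
  - exact: oss.
have srs : (size s < \dim {:V})%N.
  have := orthogonal_free ors; rewrite /free => /eqP fr.
  by have := dimvS (subvf <<r :: s>>%VS); rewrite fr /=.
have [|t] := IH (r :: s) _ ors; first by rewrite /= subnS -ltnS prednK ?subn_gt0.
by rewrite -cat_rcons => ?; exists (rcons t r).
Qed.

Lemma orthobasis_of_size s :
  pairwise_orthogonal ip s -> size s = \dim {:V} -> orthobasis s.
Proof.
move=> os ss; have [t ts] := orthobasis_extend os.
have := orthobasis_size ts; rewrite size_cat ss => /eqP.
rewrite -[X in _ == X]add0n eqn_add2r size_eq0 => /eqP t0.
by rewrite t0 in ts.
Qed.

Lemma ex_orthogonal s : pairwise_orthogonal ip s -> (size s < \dim {:V})%N ->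
  exists y, pairwise_orthogonal ip (y :: s).
Proof.
move=> os ss; have [t [ots st]] := orthobasis_extend os.
have := orthobasis_size (conj ots st); rewrite size_cat.
case: t ots {st} => [|y t] ots; first by rewrite add0n => E; rewrite E ltnn in ss.
exists y; apply: (sub_pairwise_orthogonal _ _ ots).
  by move=> z; rewrite !(inE, mem_cat) => /orP[->//|->]; rewrite !orbT.
have sub : subseq (y :: s) ((y :: t) ++ s) by rewrite /= eqxx suffix_subseq.
by apply: (subseq_uniq sub); have /pairwise_orthogonalP[/andP[]] := ots.
Qed.

Definition context s : {fset 'End(V)} := [fset proj x | x in s]%fset.

Lemma contextP s P : reflect (exists2 x, x \in s & P = proj x) (P \in context s).
Proof. exact: imfsetP. Qed.

Lemma perm_context s : pairwise_orthogonal ip s -> perm_eq (context s) (map proj s).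
Proof.
move=> /pairwise_orthogonalP[/= /andP[s0 us] oss]; apply: uniq_perm => //.
  rewrite map_inj_in_uniq // => x y xs ys xy.
  have x0 : x != 0 by apply: contraNneq s0 => <-.
  have [k k0 yE] := proj_inj x0 xy.
  apply: contraTeq isT => /(oss x y xs ys); rewrite yE ipZr => /eqP.
  by rewrite mulf_eq0 conjC_eq0 (negPf k0) dnorm_eq0 (negPf x0).
by move=> P; apply/contextP/mapP.
Qed.

Lemma maximal_context s : orthobasis s -> maximal_measurement ip (context s).
Proof.
move=> [os s1]; have /pairwise_orthogonalP[/= /andP[s0 us] oss] := os.
have nz x : x \in s -> x != 0 by move=> xs; apply: contraNneq s0 => <-.
split; [split|].
- move=> _ /contextP[x xs ->]; split; first exact: orthogonal_projection_proj.
  by apply/eqP/proj_neq0/nz.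
- move=> _ _ /contextP[x xs ->] /contextP[y ys ->] xy; apply: proj_comp_orth.
  by apply: oss => //; apply: contra_not_neq xy => ->.
- by rewrite (perm_big _ (perm_context os)) big_map.
- by move=> _ /contextP[x xs ->]; rewrite limg_proj dim_vline nz.
Qed.

(** With [maximal_context], this allows measurements to be handled as lists of vectors. *)
Lemma maximal_orthobasis M : maximal_measurement ip M ->
  exists2 s, orthobasis s & M = context s.
Proof.
move=> [[MP Morth M1] Mdim].
have ex P : exists x, P \in M -> x != 0 /\ P = proj x.
  have [PM|PM] := boolP (P \in M); last by exists 0.
  by have [x x0 ->] := rank_one_proj (MP P PM).1 (Mdim P PM); exists x.
have [r rP] := choice ex.
have rE P : P \in M -> proj (r P) = P by move=> /rP[_ {2}->].
exists (map r M); last first.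
  apply/fsetP => P; apply/idP/contextP => [PM|[_ /mapP[Q QM ->] ->]].
    by exists (r P); rewrite ?map_f // rE.
  by rewrite rE.
split; last by rewrite big_map -[RHS]M1; apply: eq_big_seq => P /rE.
apply/pairwise_orthogonalP; split.
  rewrite /= map_inj_in_uniq ?fset_uniq ?andbT; last first.
    by move=> P Q PM QM PQ; rewrite -(rE P PM) -(rE Q QM) PQ.
  by apply/mapP => -[P /rP[x0 _] r0]; rewrite -r0 eqxx in x0.
move=> _ _ /mapP[P PM ->] /mapP[Q QM ->] PQ; apply: proj_comp_eq0.
by rewrite !rE //; apply: Morth => //; apply: contra_neq_not PQ => ->.
Qed.

End Projections.
(** * Gleason's theorem in complex spaces *)

Section ComplexParts.
Variable R : realType.
Implicit Types (z w : R[i]) (r : R).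

Notation re z := (complex.Re z).
Notation im z := (complex.Im z).

Lemma reM z w : re (z * w) = re z * re w - im z * im w.
Proof. by case: z w => a b [c d]. Qed.

Lemma imM z w : im (z * w) = re z * im w + im z * re w.
Proof. by case: z w => a b [c d]. Qed.

Lemma reD z w : re (z + w) = re z + re w.
Proof. by case: z w => a b [c d]. Qed.

Lemma imD z w : im (z + w) = im z + im w.
Proof. by case: z w => a b [c d]. Qed.

Lemma reJ z : re z^* = re z. Proof. by case: z. Qed.

Lemma imJ z : im z^* = - im z. Proof. by case: z. Qed.

Lemma conj_real_complex r : (r%:C%C)^* = r%:C%C.
Proof. by apply/eqP; rewrite eq_complex /= oppr0 !eqxx. Qed.

Definition nrm2 z : R := re z ^+ 2 + im z ^+ 2.

Lemma mul_conj_nrm2 z : z * z^* = (nrm2 z)%:C%C.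
Proof.
apply/eqP; rewrite eq_complex reM imM reJ imJ /nrm2 /=.
by apply/andP; split; apply/eqP; ring.
Qed.

Lemma nrm2_gt0 z : z != 0 -> 0 < nrm2 z.
Proof.
move=> z0; rewrite lt_neqAle addr_ge0 ?sqr_ge0 // andbT eq_sym.
apply: contraNneq z0 => /eqP; rewrite paddr_eq0 ?sqr_ge0 // !sqrf_eq0.
by rewrite eq_complex.
Qed.

Lemma unit_sqrt z : nrm2 z = 1 -> exists w, nrm2 w = 1 /\ w ^+ 2 = z.
Proof.
move=> z1; exists (sqrtc z); split; last exact: sqr_sqrtc.
have : nrm2 (sqrtc z) ^+ 2 = 1.
  rewrite -z1 -{2}(sqr_sqrtc z) /nrm2 expr2 reM imM; ring.
move/eqP; rewrite sqrf_eq1 => /orP[/eqP//|/eqP].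
have : 0 <= nrm2 (sqrtc z) by rewrite addr_ge0 ?sqr_ge0.
by move=> + E; rewrite E oppr_ge0 ler10.
Qed.

End ComplexParts.

Section ComplexGleason.
Variables (R : realType) (V : vectType R[i]) (ip : {dot V for conjC}).
Variable f : V -> R.
Hypotheses (dimV : (3 <= \dim {:V})%N).
Hypotheses (fZ : forall k x, k != 0 -> f (k *: x) = f x)
  (f01 : forall x, x != 0 -> 0 <= f x <= 1)
  (f1 : forall s, orthobasis ip s -> \sum_(x <- s) f x = 1).
Implicit Types (x y a b c : V) (k : R[i]) (u v : R * R * R).

Notation re z := (complex.Re z).
Notation im z := (complex.Im z).

Definition normsq x : R := re (ip x x).

Lemma normsqE x : ip x x = (normsq x)%:C%C.
Proof.
rewrite /normsq RRe_real //; apply: ger0_real; exact: dnorm_ge0.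
Qed.

Lemma normsq_gt0 x : x != 0 -> 0 < normsq x.
Proof. by rewrite -(dnorm_gt0 ip) normsqE ltcR. Qed.

Lemma normsqZ k x : normsq (k *: x) = nrm2 k * normsq x.
Proof.
apply: complexI; rewrite -normsqE ipZl ipZr mulrA mul_conj_nrm2 normsqE.
by rewrite rmorphM.
Qed.

(** The factor [normsq x] makes the value at [0] independent of [f 0]. *)
Definition quad x : R := f x * normsq x.

Lemma quadZ k x : quad (k *: x) = nrm2 k * quad x.
Proof.
have [->|k0] := eqVneq k 0.
  by rewrite scale0r /quad /nrm2 /normsq linear0r /= expr0n addr0 mulr0 mul0r.
by rewrite /quad fZ // normsqZ; ring.
Qed.

Lemma quad_ge0 x : 0 <= quad x.
Proof.
have [->|x0] := eqVneq x 0; first by rewrite /quad /normsq linear0r mulr0.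
by have /andP[f0 _] := f01 x0; rewrite mulr_ge0 // ltW // normsq_gt0.
Qed.

Definition real_span a b c u : V :=
  u.1.1%:C%C *: a + u.1.2%:C%C *: b + u.2%:C%C *: c.

(** * Restriction to real three-dimensional subspaces *)

Section RealSubspace.
Variables (a b c : V) (n : R).
Hypotheses (n0 : 0 < n) (aa : normsq a = n) (bb : normsq b = n)
  (cc : normsq c = n) (ab : ip a b = 0) (ac : ip a c = 0) (bc : ip b c = 0).

Lemma ip_real_span u v :
  ip (real_span a b c u) (real_span a b c v) = (n * dot u v)%:C%C.
Proof.
have ba := ip_eq0C ab; have ca := ip_eq0C ac; have cb := ip_eq0C bc.
rewrite /real_span !ipDl !ipDr !ipZl !ipZr !conj_real_complex !normsqE.
rewrite aa bb cc ab ac bc ba ca cb /dot !rmorphM !rmorphD !rmorphM /=.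
by ring.
Qed.

Lemma real_span_neq0 u : 0 < dot u u -> real_span a b c u != 0.
Proof.
by move=> u0; rewrite -(dnorm_gt0 ip) ip_real_span ltcR mulr_gt0.
Qed.

(** Fix [t] completing [a], [b], [c] to an orthogonal basis: it also completes every real orthogonal
    triple in their real span. *)
Lemma real_span_frame : exists W, frame_function (f \o real_span a b c) W.
Proof.
have orth (x y z : V) : x != 0 -> y != 0 -> z != 0 -> ip x y = 0 -> ip y z = 0 ->
    ip x z = 0 -> pairwise_orthogonal ip [:: x; y; z].
  move=> x0 y0 z0 xy yz xz; rewrite /pairwise_orthogonal /= !inE !negb_or.
  by rewrite eq_sym x0 eq_sym y0 eq_sym z0 xy yz xz !eqxx.
have E1 : real_span a b c (1, 0, 0) = a.
  by rewrite /real_span /= !scale0r !addr0 scale1r.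
have E2 : real_span a b c (0, 1, 0) = b.
  by rewrite /real_span /= !scale0r addr0 add0r scale1r.
have E3 : real_span a b c (0, 0, 1) = c.
  by rewrite /real_span /= !scale0r !add0r scale1r.
have a0 : a != 0 by rewrite -E1 real_span_neq0 // dot_e1.
have b0 : b != 0 by rewrite -E2 real_span_neq0 // dot_e2.
have c0 : c != 0 by rewrite -E3 real_span_neq0 // dot_pole.
have [t [ot st]] := orthobasis_extend (orth a b c a0 b0 c0 ab bc ac).
exists (1 - \sum_(x <- t) f x); split=> [k u k0|u v w u0 v0 w0 uv vw uw] /=.
  rewrite -[RHS](fZ (k := k%:C%C)); last by rewrite eq_complex /= eqxx andbT.
  by congr f; rewrite /real_span !scalerDr !scalerA -!rmorphM.
pose s := [:: real_span a b c u; real_span a b c v; real_span a b c w].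
have os : pairwise_orthogonal ip s.
  by apply: orth; rewrite ?real_span_neq0 // ip_real_span ?uv ?vw ?uw mulr0.
have : orthobasis ip (t ++ s).
  apply: orthobasis_of_size; last first.
    by rewrite -(orthobasis_size (conj ot st)) !size_cat.
  move: ot; rewrite !pairwise_orthogonal_cat => /and3P[-> _ /orthogonalP tabc].
  rewrite os /=; apply/orthogonalP => x y xt ys.
  have [xa xb xc] : [/\ ip x a = 0, ip x b = 0 & ip x c = 0].
    by split; apply: tabc; rewrite // !inE eqxx ?orbT.
  have rs q : ip x (real_span a b c q) = 0.
    by rewrite /real_span !ipDr !ipZr xa xb xc !mulr0 !addr0.
  by move: ys; rewrite !inE => /or3P[] /eqP ->; apply: rs.
by move=> /f1; rewrite big_cat /= !big_cons big_nil addr0 => <-; ring.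
Qed.

Lemma real_span_quadratic : exists g : R, forall s t : R,
  quad (s%:C%C *: a + t%:C%C *: b) = s ^+ 2 * quad a + t ^+ 2 * quad b + s * t * g.
Proof.
have [W fW] := real_span_frame.
have fb : bounded3 (f \o real_span a b c) 0 1.
  by move=> u u0; apply: f01; apply: real_span_neq0.
have [p [q [r [x [y [z [_ fE]]]]]]] := gleason3 fW fb.
pose F s t := n * (x * (s * p.1.1 + t * p.1.2) ^+ 2
   + y * (s * q.1.1 + t * q.1.2) ^+ 2 + z * (s * r.1.1 + t * r.1.2) ^+ 2).
have QF s t : quad (s%:C%C *: a + t%:C%C *: b) = F s t.
  have -> : s%:C%C *: a + t%:C%C *: b = real_span a b c (s, t, 0).
    by rewrite /real_span /= scale0r addr0.
  have [st|st] := eqVneq (s ^+ 2 + t ^+ 2) 0.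
    have /andP[/eqP -> /eqP ->] : (s == 0) && (t == 0).
      by move/eqP: st; rewrite paddr_eq0 ?sqr_ge0 // !sqrf_eq0.
    rewrite /quad /normsq ip_real_span /dot /F /=; ring.
  have st0 : 0 < dot (s, t, 0) (s, t, 0).
    rewrite /dot /= mulr0 addr0 -!expr2 lt_neqAle eq_sym st.
    by rewrite addr_ge0 ?sqr_ge0.
  have := fE _ st0; rewrite /= => E.
  transitivity (n * (f (real_span a b c (s, t, 0)) * dot (s, t, 0) (s, t, 0))).
    by rewrite /quad /normsq ip_real_span /=; ring.
  by rewrite E /F /dot /=; ring.
have Qa : quad a = F 1 0 by rewrite -QF scale0r scale1r addr0.
have Qb : quad b = F 0 1 by rewrite -QF scale0r scale1r add0r.
exists (2 * n * (x * p.1.1 * p.1.2 + y * q.1.1 * q.1.2 + z * r.1.1 * r.1.2)) => s t.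
by rewrite QF Qa Qb /F; ring.
Qed.

End RealSubspace.

Lemma rescale x (n : R) : x != 0 -> 0 < n ->
  exists2 k : R, 0 < k & normsq (k%:C%C *: x) = n.
Proof.
move=> x0 n0; exists (Num.sqrt (n / normsq x)).
  by rewrite sqrtr_gt0 divr_gt0 // normsq_gt0.
rewrite normsqZ /nrm2 /= expr0n addr0 sqr_sqrtr ?divfK ?gt_eqF ?normsq_gt0 //.
by rewrite divr_ge0 ?ltW ?normsq_gt0.
Qed.

(** The dimension bound supplies the third orthogonal vector. The common squared norm [n] is left
    free because [cross_term] uses both [1] and [2]. *)
Lemma real_plane a b (n : R) :
  0 < n -> normsq a = n -> normsq b = n -> ip a b = 0 ->
  exists g : R, forall s t : R,
  quad (s%:C%C *: a + t%:C%C *: b) = s ^+ 2 * quad a + t ^+ 2 * quad b + s * t * g.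
Proof.
move=> n0 aa bb ab.
have a0 : a != 0 by rewrite -(dnorm_gt0 ip) normsqE aa ltcR.
have b0 : b != 0 by rewrite -(dnorm_gt0 ip) normsqE bb ltcR.
have oab : pairwise_orthogonal ip [:: a; b].
  by rewrite /pairwise_orthogonal /= !inE !negb_or eq_sym a0 eq_sym b0 ab !eqxx.
have [c /pairwise_orthogonal_head[c0 cab]] := ex_orthogonal oab dimV.
have ac : ip a c = 0 by apply: cab; rewrite inE eqxx.
have bc : ip b c = 0 by apply: cab; rewrite !inE eqxx orbT.
have [k k0 cc] := rescale c0 n0.
apply: (@real_span_quadratic a b (k%:C%C *: c) n) => //.
- by rewrite ipZr ac mulr0.
- by rewrite ipZr bc mulr0.
Qed.

(* The cross term [gamma u] of [quad] on [span(a, u b)] is real linear in the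
   phase [u]: writing [u = w ^+ 2], the vector [a + u b] is proportional to
   [w^* a + w b], which lies in the real span of [a + b] and [i (a - b)]. *)
Lemma cross_term a b : normsq a = 1 -> normsq b = 1 -> ip a b = 0 ->
  exists g h : R, forall z, quad (a + z *: b) =
    quad a + nrm2 z * quad b + re z * g + im z * h.
Proof.
move=> aa bb ab; have ba := ip_eq0C ab.
pose gamma z := quad (a + z *: b) - quad a - quad b.
(* For a fixed phase [w], the real plane of [a] and [w *: b] makes the cross term linear in [t]. *)
have phase w (t : R) : nrm2 w = 1 ->
    quad (a + (t%:C%C * w) *: b) = quad a + t ^+ 2 * quad b + t * gamma w.
  move=> w1; have wbb : normsq (w *: b) = 1 by rewrite normsqZ w1 bb mulr1.
  have wab : ip a (w *: b) = 0 by rewrite ipZr ab mulr0.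
  have [g gE] := real_plane ltr01 aa wbb wab.
  have Qwb : quad (w *: b) = quad b by rewrite quadZ w1 mul1r.
  have E r : quad (a + r%:C%C *: (w *: b)) = quad a + r ^+ 2 * quad b + r * g.
    by have := gE 1 r; rewrite rmorph1 scale1r Qwb => ->; ring.
  by have := E 1; rewrite rmorph1 scale1r /gamma -scalerA E => ->; ring.
pose a' := a + b; pose b' := 'i%C *: (a - b).
have a'a' : normsq a' = 2.
  apply: complexI; rewrite -normsqE !ipDl !ipDr ab ba !normsqE aa bb.
  by rewrite addr0 add0r -rmorphD.
have ib : normsq (a - b) = 2.
  apply: complexI; rewrite -normsqE -scaleN1r !ipDl !ipDr !ipZl !ipZr.
  rewrite ab ba !normsqE aa bb.
  rewrite rmorphN1 !mulr0 addr0 add0r mulrA mulrNN !mulr1 -rmorphD //.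
have b'b' : normsq b' = 2 by rewrite normsqZ ib /nrm2 /=; ring.
have a'b' : ip a' b' = 0.
  rewrite ipZr -scaleN1r !ipDl !ipDr !ipZr ab ba !normsqE aa bb rmorphN1.
  by ring.
have [g' g'E] := real_plane (ltr0n _ 2) a'a' b'b' a'b'.
have one1 : nrm2 (1 : R[i]) = 1 by rewrite /nrm2 /=; ring.
have Qa' : quad a' = quad a + quad b + gamma 1.
  by have := phase 1 1 one1; rewrite mulr1 scale1r -/a' => ->; ring.
have Qb' : quad b' = quad a + quad b - gamma 1.
  have := phase 1 (-1) one1; rewrite mulr1 rmorphN1 scaleN1r quadZ => ->.
  by rewrite /nrm2 /=; ring.
(* With [w = s - i t], the cross term in the plane of [a'] and [b'] is [s * t * g'], while the
   imaginary part of [u = w ^+ 2] is [- 2 * s * t]. *)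
exists (gamma 1), (- g' / 2) => z.
have [->|z0] := eqVneq z 0.
  by rewrite scale0r addr0 /nrm2 /=; ring.
have r0 := nrm2_gt0 z0; pose r := Num.sqrt (nrm2 z).
have rE : r ^+ 2 = nrm2 z by rewrite sqr_sqrtr // ltW.
have rn : r != 0 by rewrite gt_eqF // sqrtr_gt0.
pose u := (r^-1)%:C%C * z.
have u1 : nrm2 u = 1.
  transitivity (r ^- 2 * nrm2 z); last by rewrite -rE mulVf // expf_neq0.
  by rewrite /nrm2 reM imM /=; field.
have zE : z = r%:C%C * u by rewrite mulrA -rmorphM divff // mul1r.
have [w [w1 wu]] := unit_sqrt u1.
suff gu : gamma u = re u * gamma 1 + im u * (- g' / 2).
  rewrite {1}zE phase // gu -rE zE !reM !imM /=; ring.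
pose s := re w; pose t := - im w.
have spanE : s%:C%C *: a' + t%:C%C *: b' = w^* *: (a + u *: b).
  have -> : w^* *: (a + u *: b) = w^* *: a + w *: b.
    rewrite scalerDr scalerA -wu expr2 mulrA [w^* * w]mulrC mul_conj_nrm2 w1.
    by rewrite rmorph1 mul1r.
  rewrite /a' /b' scalerA !scalerDr scalerN addrACA -scalerDl -scalerBl.
  congr (_ *: _ + _ *: _); apply/eqP; rewrite eq_complex /s /t; case: (w) => p q /=.
    by apply/andP; split; apply/eqP; ring.
  by apply/andP; split; apply/eqP; ring.
have := g'E s t; rewrite spanE quadZ Qa' Qb'.
have -> : nrm2 w^* = 1 by rewrite -w1 /nrm2 reJ imJ sqrrN.
have -> : quad (a + u *: b) = gamma u + quad a + quad b by rewrite /gamma; ring.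
have w1' : s ^+ 2 + t ^+ 2 = 1 by rewrite /s /t sqrrN.
have -> : re u = s ^+ 2 - t ^+ 2 by rewrite -wu expr2 reM /s /t; ring.
have -> : im u = - (2 * s * t) by rewrite -wu expr2 imM /s /t; ring.
move=> E; have -> : gamma u = s ^+ 2 * (quad a + quad b + gamma 1)
   + t ^+ 2 * (quad a + quad b - gamma 1) + s * t * g'
   - (s ^+ 2 + t ^+ 2) * (quad a + quad b).
  by rewrite w1'; lra.
by field.
Qed.

(* [|z|^2 al + |w|^2 be + Re (w z^* ) ga + Im (w z^* ) de] *)
Definition hform (al be ga de : R) (z w : R[i]) : R :=
  nrm2 z * al + nrm2 w * be + (re w * re z + im w * im z) * ga
  + (im w * re z - re w * im z) * de.

Lemma quad_orthonormal a b : normsq a = 1 -> normsq b = 1 -> ip a b = 0 ->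
  exists ga de, forall z w,
    quad (z *: a + w *: b) = hform (quad a) (quad b) ga de z w.
Proof.
move=> aa bb ab; have [g [h gh]] := cross_term aa bb ab.
exists g, h => z w; have [->|z0] := eqVneq z 0.
  by rewrite scale0r add0r quadZ /hform /nrm2 /=; ring.
have -> : w = w / z * z by rewrite divfK.
move: (w / z) => q.
have -> : z *: a + (q * z) *: b = z *: (a + q *: b).
  by rewrite scalerDr scalerA mulrC.
by rewrite quadZ gh /hform /nrm2 !reM !imM; ring.
Qed.

Lemma ex_orthonormal2 x y : exists a b k l m,
  [/\ normsq a = 1, normsq b = 1 & ip a b = 0] /\
  x = k *: a /\ y = l *: a + m *: b.
Proof.
have ex s : pairwise_orthogonal ip s -> (size s < 3)%N ->
    exists2 b, normsq b = 1 & {in s, forall a, ip a b = 0}.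
  move=> os ss.
  have [c] := ex_orthogonal os (leq_trans ss dimV).
  move=> /pairwise_orthogonal_head[c0 ocs].
  have [k k0 ck] := rescale c0 ltr01.
  by exists (k%:C%C *: c) => // a sa; rewrite ipZr ocs ?mulr0.
have [a [k [aa xE]]] : exists a k, normsq a = 1 /\ x = k *: a.
  have [->|x0] := eqVneq x 0.
    have [//|//|a aa _] := ex [::].
    by exists a, 0; rewrite scale0r.
  have [k k0 xk] := rescale x0 ltr01.
  exists (k%:C%C *: x), (k^-1)%:C%C; split=> //.
  by rewrite scalerA -rmorphM mulVf ?scale1r // gt_eqF.
have a0 : a != 0 by rewrite -(dnorm_gt0 ip) normsqE aa ltcR ltr01.
pose r := y - ip y a *: a.
have ra : ip r a = 0.
  by rewrite /r linearBl /= ipZl normsqE aa mulr1 subrr.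
have [b [m [bb ab rE]]] : exists b m, [/\ normsq b = 1, ip a b = 0 & r = m *: b].
  have [->|r0] := eqVneq r 0.
    have [|//|b bb ob] := ex [:: a].
      by rewrite /pairwise_orthogonal /= inE eq_sym a0.
    by exists b, 0; rewrite scale0r ob ?inE.
  have [m m0 rm] := rescale r0 ltr01.
  exists (m%:C%C *: r), (m^-1)%:C%C; split=> //.
    by rewrite ipZr (ip_eq0C ra) mulr0.
  by rewrite scalerA -rmorphM mulVf ?scale1r // gt_eqF.
exists a, b, k, (ip y a), m; split=> //; split=> //.
by rewrite -rE /r addrC subrK.
Qed.

Lemma quad_hform x y : exists al be ga de, forall z w,
  quad (z *: x + w *: y) = hform al be ga de z w.
Proof.
have [a [b [k [l [m [[aa bb ab] [-> ->]]]]]]] := ex_orthonormal2 x y.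
have [ga [de QE]] := quad_orthonormal aa bb ab.
pose F := hform (quad a) (quad b) ga de.
(* The two cross coefficients are read off the values of [quad] at [x + y] and [x + i y]. *)
pose g := F (k + l) m - F k 0 - F l m.
pose h := F (k + 'i%C * l) ('i%C * m) - F k 0 - F l m.
exists (F k 0), (F l m), g, h => z w.
have -> : z *: (k *: a) + w *: (l *: a + m *: b) =
    (z * k + w * l) *: a + (w * m) *: b.
  by rewrite scalerDr !scalerA addrA -scalerDl.
rewrite QE /g /h /F /hform /nrm2 !(reM, imM, reD, imD) /=.
by ring.
Qed.

(** * Polarization and the density operator *)

Lemma parallelogram x y : quad (x + y) + quad (x - y) = 2 * quad x + 2 * quad y.
Proof.
have [al [be [ga [de QE]]]] := quad_hform x y.
have := QE 1 1; have := QE 1 (-1); have := QE 1 0; have := QE 0 1.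
rewrite !scale1r scaleN1r !scale0r addr0 add0r => -> -> -> ->.
by rewrite /hform /nrm2 /=; ring.
Qed.

Definition polar x y : R := quad (x + y) - quad (x - y).

Lemma quadN x : quad (- x) = quad x.
Proof. by rewrite -scaleN1r quadZ /nrm2 /=; ring. Qed.

Lemma polarC x y : polar x y = polar y x.
Proof.
by rewrite /polar [y + x]addrC -[y - x]opprB quadN.
Qed.

(** The Jordan-von Neumann argument: two instances of the parallelogram law give [h]; its cases
    [z = y] and [z = - y] are subtracted, and the bracket they share cancels. *)
Lemma polarDl x1 x2 y : polar (x1 + x2) y = polar x1 y + polar x2 y.
Proof.
have h z : 2 * quad (x1 + x2 + z) + (quad (x1 - x2 + z) + quad (x1 - x2 - z)) =
    2 * quad (x1 + z) + 2 * quad (x2 + z) + 2 * quad x1 + 2 * quad x2.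
  have := parallelogram (x1 + z) x2; have := parallelogram (x2 + z) x1.
  have -> : quad (x2 + z - x1) = quad (x1 - x2 - z).
    by rewrite -quadN opprB opprD addrA.
  have -> : x2 + z + x1 = x1 + x2 + z by rewrite addrC addrA.
  have -> : x1 + z + x2 = x1 + x2 + z by rewrite addrAC.
  have -> : x1 + z - x2 = x1 - x2 + z by rewrite addrAC.
  lra.
have := h y; have := h (- y); rewrite opprK /polar; lra.
Qed.

Lemma polarDr x y1 y2 : polar x (y1 + y2) = polar x y1 + polar x y2.
Proof. by rewrite polarC polarDl !(polarC x). Qed.

(** The complex polarization formula, for a form linear in its first argument. *)
Definition herm x y : R[i] := (polar x y / 4 +i* (polar x ('i%C *: y) / 4))%C.

Lemma hermDl x1 x2 y : herm (x1 + x2) y = herm x1 y + herm x2 y.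
Proof. by rewrite /herm !polarDl !mulrDl. Qed.

Lemma hermDr x y1 y2 : herm x (y1 + y2) = herm x y1 + herm x y2.
Proof. by rewrite /herm scalerDr !polarDr !mulrDl. Qed.

Lemma polar_hform x y : exists ga de, forall z w : R[i], polar (z *: x) (w *: y) =
  2 * ((re w * re z + im w * im z) * ga + (im w * re z - re w * im z) * de).
Proof.
have [al [be [ga [de QE]]]] := quad_hform x y; exists ga, de => z w.
rewrite /polar QE -[- (w *: y)]scaleNr QE /hform /nrm2 /=.
by case: z w => [p q] [r s] /=; ring.
Qed.

(** Unlike additivity, homogeneity involves only the complex span of [x] and [y], where [polar] is
    explicit. *)
Lemma hermZl k x y : herm (k *: x) y = k * herm x y.
Proof.
have [ga [de PE]] := polar_hform x y.
have P1 z : polar (z *: x) y = 2 * (re z * ga - im z * de).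
  by have := PE z 1; rewrite scale1r => ->; rewrite /=; ring.
have Pi z : polar (z *: x) ('i%C *: y) = 2 * (im z * ga + re z * de).
  by rewrite PE /=; ring.
have := P1 1; have := Pi 1; rewrite scale1r /herm P1 Pi => -> ->.
case: k => p q; apply/eqP; rewrite eq_complex /=.
by apply/andP; split; apply/eqP; field.
Qed.

Lemma hermZr k x y : herm x (k *: y) = k^* * herm x y.
Proof.
have [ga [de PE]] := polar_hform x y.
have {}PE w : polar x (w *: y) = 2 * (re w * ga + im w * de).
  by have := PE 1 w; rewrite scale1r => ->; rewrite /=; ring.
rewrite /herm scalerA -[in polar x y](scale1r y) !PE.
case: k => p q; apply/eqP; rewrite eq_complex /=.
by apply/andP; split; apply/eqP; field.
Qed.

Lemma herm_diag x : herm x x = (quad x)%:C%C.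
Proof.
have Qx k : quad (k *: x) = nrm2 k * quad x := quadZ k x.
have E1 : polar x x = 4 * quad x.
  rewrite /polar subrr -(scale0r x) -{1 2}(scale1r x) -scalerDl !Qx /nrm2 /=; ring.
have E2 : polar x ('i%C *: x) = 0.
  rewrite /polar -{1 3}(scale1r x) -scalerDl -scalerBl !Qx /nrm2 /=; ring.
by rewrite /herm E1 E2 mul0r; congr (_ +i* _)%C; field.
Qed.

(** Riesz representation of [herm] gives [rho], with [ip (rho x) x = quad x]; positivity is that of
    [quad], and the trace is the sum of [f] over an orthogonal basis. *)
Theorem gleason_density : exists rho : 'End(V), density_operator ip rho /\
  forall x, x != 0 -> (f x)%:C%C = lftrace (rho \o proj ip x)%VF.
Proof.
have ex y : exists g, forall x, herm x y = ip x g.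
  pose h x : R[i]^o := herm x y.
  have hl : linear h by move=> k u v; rewrite /h hermDl hermZl.
  pose hL : {linear V -> R[i]^o} := HB.pack h (GRing.isLinear.Build _ _ _ _ h hl).
  by have [g gE] := riesz ip hL; exists g => x; rewrite -gE.
have [g gE] := choice ex.
have gl : linear g.
  move=> k u v; apply: (@ip_inj _ _ ip) => x; rewrite -gE ipDr ipZr -!gE.
  by rewrite hermDr hermZr.
pose gL : {linear V -> V} := HB.pack g (GRing.isLinear.Build _ _ _ _ g gl).
exists (linfun gL).
have rhoE x : ip (linfun gL x) x = (quad x)%:C%C.
  by rewrite lfunE /= ipC -gE herm_diag conj_real_complex.
have tr x : x != 0 -> (f x)%:C%C = lftrace (linfun gL \o proj ip x)%VF.
  move=> x0; rewrite lftrace_proj rhoE normsqE /quad rmorphM mulfK //.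
  by rewrite eq_complex /= eqxx andbT gt_eqF // normsq_gt0.
split=> //; split=> [x|]; first by rewrite rhoE ler0c quad_ge0.
have [s] := @orthobasis_extend _ _ ip [::] isT; rewrite cats0 => obs.
have [os s1] := obs; rewrite -[linfun gL]comp_lfun1r -s1 comp_lfun_sumr lftrace_sum.
rewrite -[RHS](rmorph1 (real_complex R)) -(f1 obs) rmorph_sum /=.
apply: eq_big_seq => x xs; rewrite -tr //.
by have /pairwise_orthogonalP[/= /andP[s0 _] _] := os; apply: contraNneq s0 => <-.
Qed.

End ComplexGleason.
(** * Invariance and context independence *)

Section Assignments.
Variables (R : realType) (V : vectType R[i]) (ip : {dot V for conjC}).
Variable w : 'End(V) -> {fset 'End(V)} -> R.
Hypotheses (dimV : (3 <= \dim {:V})%N) (hw : probability_assignment ip w).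
Implicit Types (A B P Q U : 'End(V)) (x y z v : V) (k : R[i]).
Implicit Types (M N : {fset 'End(V)}).

Lemma adjointPr A x y : ip (adjoint ip A x) y = ip x (A y).
Proof. by rewrite ipC -adjointP -ipC. Qed.

Lemma unitary_ip U x y : unitary ip U -> ip (U x) (U y) = ip x y.
Proof. by move=> [UU _]; rewrite adjointP -comp_lfunE UU lfunE. Qed.

Lemma conj_proj U x : unitary ip U ->
  (U \o (proj ip x \o adjoint ip U))%VF = proj ip (U x).
Proof.
move=> Uu; apply/lfunP => y.
by rewrite !comp_lfunE !projE linearZ /= adjointPr unitary_ip.
Qed.

Lemma conj_context U s : unitary ip U ->
  conj_measurement ip U (context ip s) = context ip (map U s).
Proof.
move=> Uu; apply/fsetP => P; apply/imfsetP/contextP.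
  by move=> [_ /contextP[x xs ->] ->]; exists (U x); rewrite ?map_f ?conj_proj.
move=> [_ /mapP[x xs ->] ->]; exists (proj ip x); rewrite ?conj_proj //=.
by apply/contextP; exists x.
Qed.

Lemma maximal_conj U M : unitary ip U -> maximal_measurement ip M ->
  maximal_measurement ip (conj_measurement ip U M).
Proof.
move=> Uu /maximal_orthobasis[s obs ->]; rewrite conj_context //.
apply: maximal_context; apply: orthobasis_of_size; last first.
  by rewrite size_map (orthobasis_size obs).
have Uinj : injective U.
  move=> x y Uxy; have [UU _] := Uu.
  by rewrite -[x]id_lfunE -[y]id_lfunE -UU !comp_lfunE Uxy.
have [/pairwise_orthogonalP[/= /andP[s0 us] oss] _] := obs.
apply/pairwise_orthogonalP; split.
  rewrite /= map_inj_uniq // us andbT -(linear0 U) mem_map //.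
move=> _ _ /mapP[x xs ->] /mapP[y ys ->]; rewrite unitary_ip // => xy.
by apply: oss => //; apply: contra_neq xy => ->.
Qed.

Lemma conj_mem P U M : maximal_measurement ip M -> P \in M ->
  complementary_unitary ip P U -> P \in conj_measurement ip U M.
Proof.
move=> /maximal_orthobasis[s obs ->] /contextP[x xs PE] [Uu Ux].
rewrite conj_context //; apply/contextP; exists x; last by [].
rewrite -[x]Ux ?map_f // PE limg_proj; exact: memv_line.
Qed.

Lemma context_independent_invariant : context_independent ip w ->
  complementary_unitary_invariant ip w.
Proof.
move=> ci M P U mM PM PU; apply: ci => //; last exact: conj_mem.
by apply: maximal_conj => //; case: PU.
Qed.

Lemma invariant_two_level : complementary_unitary_invariant ip w ->
  two_level_complementary_unitary_invariant ip w.
Proof. by move=> inv M P U mM PM [PU _]; apply: inv. Qed.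

Lemma represents_context_independent (rho : 'End(V)) : represents ip rho w ->
  context_independent ip w.
Proof. by move=> rep M N P mM mN PM PN; apply: complexI; rewrite !rep. Qed.

(** An element of [M] outside [N] would annihilate every element of [N], hence the identity. *)
Lemma maximal_sub M N : maximal_measurement ip M -> maximal_measurement ip N ->
  (N `<=` M)%fset -> M = N.
Proof.
move=> [[M0 Mo _] _] [[_ _ N1] _] NM; apply/eqP; rewrite eqEfsubset NM andbT.
apply/fsubsetP => Q QM; apply: contrapT => /negP QN.
have [_ []] := M0 Q QM; rewrite -[Q]comp_lfun1r -N1 comp_lfun_sumr.
rewrite big_seq big1 // => A AN; apply: Mo => //; first exact: (fsubsetP NM).
by move=> QA; rewrite QA AN in QN.
Qed.

Lemma maximal_proj M P : maximal_measurement ip M -> P \in M ->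
  exists2 x, x != 0 & P = proj ip x.
Proof.
move=> [[Mp _ _] Md] PM.
by apply: rank_one_proj; [apply: (Mp P PM).1|apply: Md].
Qed.

Lemma proj_mem_orth M x y : maximal_measurement ip M ->
  proj ip x \in M -> proj ip y \in M -> proj ip x <> proj ip y -> ip x y = 0.
Proof. by move=> [[_ Mo _] _] xM yM xy; apply: proj_comp_eq0; apply: Mo. Qed.

(** * Exchanging two lines by a reflection *)

(** Equal norms and a real inner product are what [reflection_swap] needs; [k] combines a positive
    scale with the phase of [ip x y]. *)
Lemma align x y : x != 0 -> y != 0 -> exists k,
  [/\ k != 0, ip (k *: y) (k *: y) = ip x x & ip x (k *: y) = ip (k *: y) x].
Proof.
move=> x0 y0; have [r r0 rE] := rescale ip y0 (normsq_gt0 ip x0).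
have rn : r%:C%C != 0 :> R[i] by rewrite eq_complex /= eqxx andbT gt_eqF.
have [xy|xy] := eqVneq (ip x y) 0.
  exists r%:C%C; split; rewrite ?normsqE ?rE //.
  by rewrite ipZr ipZl xy (ip_eq0C xy) !mulr0.
have nxy : `|ip x y| != 0 by rewrite normr_eq0.
have nJ : (`|ip x y|^*) = `|ip x y| by apply: conj_normC.
exists (ip x y / `|ip x y| * r%:C%C); split.
- by rewrite !mulf_neq0 ?invr_eq0.
- rewrite !normsqE; congr _%:C%C; rewrite -scalerA normsqZ rE.
  suff -> : nrm2 (ip x y / `|ip x y|) = 1 by rewrite mul1r.
  apply: complexI; rewrite -mul_conj_nrm2 rmorphM /= fmorphV /= nJ mulrACA.
  by rewrite -normCK -invfM -expr2 divff // expf_neq0.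
- rewrite ipZr ipZl !rmorphM /= fmorphV /= nJ conj_real_complex [ip y x]ipC.
  by ring.
Qed.

Definition reflection v : 'End(V) := (\1 - (2 : R[i]) *: proj ip v)%VF.

Lemma reflectionE v x : reflection v x = x - (2 * (ip x v / ip v v)) *: v.
Proof. by rewrite add_lfunE opp_lfunE scale_lfunE id_lfunE projE scalerA. Qed.

Lemma reflection_fix v x : ip x v = 0 -> reflection v x = x.
Proof. by move=> xv; rewrite reflectionE xv mul0r mulr0 scale0r subr0. Qed.

Lemma reflection_unitary v : unitary ip (reflection v).
Proof.
have adj : adjoint ip (reflection v) = reflection v.
  apply/lfunP => y; apply: (@ip_inj _ _ ip) => x; rewrite -adjointP !reflectionE.
  rewrite linearBl linearBr /= ipZl ipZr; congr (_ - _).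
  rewrite !rmorphM /= fmorphV /= -!ipC conjC_nat.
  by ring.
have inv : (reflection v \o reflection v)%VF = \1%VF.
  apply/lfunP => x; rewrite comp_lfunE id_lfunE !reflectionE.
  have [->|v0] := eqVneq v 0; first by rewrite !scaler0 !subr0.
  have vv : ip v v != 0 by rewrite dnorm_eq0.
  set c := 2 * (ip x v / ip v v).
  have -> : 2 * (ip (x - c *: v) v / ip v v) = - c.
    by rewrite linearBl /= ipZl /c; field.
  by rewrite scaleNr opprK subrK.
by rewrite /unitary adj.
Qed.

Lemma reflection_swap x y : ip x x = ip y y -> ip x y = ip y x -> x != y ->
  reflection (x - y) x = y.
Proof.
move=> xx xy nxy; rewrite reflectionE.
have v0 : ip (x - y) (x - y) != 0 by rewrite dnorm_eq0 subr_eq0.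
have vE : ip (x - y) (x - y) = 2 * ip x (x - y).
  rewrite linearBl !linearBr /= -xx -xy; ring.
rewrite mulrA -vE divff // scale1r opprB addrC subrK //.
Qed.

(* If [M <> N], some reflection moves an element of [M] outside [N] to an
   element of [N] outside [M] while fixing all of [M] and [N] have in common. *)
Lemma two_level_context_independent :
  two_level_complementary_unitary_invariant ip w -> context_independent ip w.
Proof.
move=> inv M N P mM mN.
(* Induction on the number of elements of [N] missing from [M]. *)
have [n] := ubnP #|` (N `\` M)%fset|; elim: n M mM => // n IH M mM ltn PM PN.
have [NM|] := boolP (N `<=` M)%fset; first by rewrite (maximal_sub mM mN NM).
move=> nNM; have nMN : ~~ (M `<=` N)%fset.
  by apply: contraNN nNM => MN; rewrite (maximal_sub mN mM MN).
have /fsubsetPn[Q QN QM] := nNM; have /fsubsetPn[A AM AN] := nMN.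
have ex B L := @maximal_proj L B.
have [x x0 AE] := ex A M mM AM; have [y0' y0 QE] := ex Q N mN QN.
have [k [k0 yy xy]] := align x0 y0.
move: (k *: y0') (projZ ip y0' k0) yy xy => y; rewrite -QE => {}QE yy xy.
have nxy : x != y by apply: contraNneq QM => xE; rewrite -QE -xE -AE.
pose v := x - y.
(* A projection common to [M] and [N] has range orthogonal to both [x] and [y], hence fixed by the
   reflection. *)
have fixB B z : B = proj ip z -> B \in M -> B \in N -> ip z v = 0.
  move=> BE BM BN; rewrite linearBr /= (proj_mem_orth mM) -?BE -?AE //; last first.
    by move=> BA; rewrite BA (negPf AN) in BN.
  rewrite (proj_mem_orth mN) -?BE ?QE ?subrr //.
  by move=> BQ; rewrite BQ (negPf QM) in BM.
pose U := reflection v; have Uu : unitary ip U := reflection_unitary v.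
have [z z0 PE] := ex P M mM PM; have zv := fixB P z PE PM PN.
have PU : two_level_complementary_unitary ip P U.
  split.
    split=> // u; rewrite PE limg_proj => /vlineP[c ->].
    by rewrite linearZ /= reflection_fix.
  exists <[v]>%VS; split.
  - rewrite -memvE; have -> : v = (\1 - P)%VF v.
      by rewrite add_lfunE opp_lfunE id_lfunE PE proj_orth ?subr0 // ip_eq0C.
    by rewrite memv_img ?memvf.
  - by rewrite dim_vline; case: (v != 0).
  - by move=> u _ uv; apply: reflection_fix; apply: uv; apply: memv_line.
rewrite -(inv M P U mM PM PU); apply: IH => //; first exact: maximal_conj.
  rewrite -ltnS; apply: leq_trans ltn; rewrite ltnS.
  (* Common elements survive the reflection and [Q] is gained, so the missing part of [N] shrinks
     strictly. *)
  apply: fproper_ltn_card; apply/andP; split.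
    apply/fsubsetP => B; rewrite !inE => /andP[BM' BN]; rewrite BN andbT.
    apply: contra BM' => BM; apply: conj_mem => //.
    have [b b0 BE] := ex B M mM BM; split=> // u.
    rewrite BE limg_proj => /vlineP[c ->].
    by rewrite linearZ /= reflection_fix // (fixB B b BE BM BN).
  apply/fsubsetPn; exists Q; rewrite !inE ?QM ?QN // negb_and negbK.
  apply/orP; left; apply/imfsetP; exists A => //=.
  by rewrite AE conj_proj // reflection_swap.
by apply: conj_mem => //; case: PU.
Qed.

(** Context independence makes [f x], the value of [w] at [proj ip x] in any measurement containing
    it, well defined, and Gleason's theorem applies. For uniqueness, every nonzero [x] lies in an
    orthogonal basis, so all [ip (rho x) x] are determined. *)
Lemma context_independent_density : context_independent ip w ->
  exists! rho : 'End(V), density_operator ip rho /\ represents ip rho w.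
Proof.
move=> ci; pose good P M := maximal_measurement ip M /\ P \in M.
have ex P : exists M, (exists M, good P M) -> good P M.
  have [[M gM]|nM] := pselect (exists M, good P M); first by exists M.
  by exists fset0 => /nM.
have [m mP] := choice ex.
pose f x := w (proj ip x) (m (proj ip x)).
have fE M x : maximal_measurement ip M -> proj ip x \in M -> f x = w (proj ip x) M.
  move=> mM xM; have [mm xm] : good (proj ip x) (m (proj ip x)).
    by apply: mP; exists M.
  exact: ci.
have fZ k x : k != 0 -> f (k *: x) = f x by move=> k0; rewrite /f projZ.
have f1 s : orthobasis ip s -> \sum_(x <- s) f x = 1.
  move=> obs; have mM := maximal_context obs.
  rewrite -(hw mM).2 (perm_big _ (perm_context obs.1)) big_map.
  apply: eq_big_seq => x xs; apply: fE => //.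
  by apply/contextP; exists x.
have f01 x : x != 0 -> 0 <= f x <= 1.
  move=> x0; have ox : pairwise_orthogonal ip [:: x].
    by rewrite /pairwise_orthogonal /= inE eq_sym x0.
  have [t obs] := orthobasis_extend ox; have mM := maximal_context obs.
  have xM : proj ip x \in context ip (t ++ [:: x]).
    by apply/contextP; exists x; rewrite // mem_cat inE eqxx orbT.
  by rewrite (fE _ _ mM xM); apply: (hw mM).1.
have [rho [drho rhoE]] := gleason_density dimV fZ f01 f1.
exists rho; split.
  split=> // M P mM PM; have [x x0 PE] := maximal_proj mM PM.
  by rewrite PE in PM *; rewrite -(fE M) // rhoE.
move=> rho' [_ rho'E].
have diag x : ip (rho x) x = ip (rho' x) x.
  have [->|x0] := eqVneq x 0; first by rewrite !linear0r.
  have ox : pairwise_orthogonal ip [:: x].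
    by rewrite /pairwise_orthogonal /= inE eq_sym x0.
  have [t obs] := orthobasis_extend ox; have mM := maximal_context obs.
  have xM : proj ip x \in context ip (t ++ [:: x]).
    by apply/contextP; exists x; rewrite // mem_cat inE eqxx orbT.
  have := rho'E _ _ mM xM; rewrite -(fE _ _ mM xM) rhoE // !lftrace_proj.
  by move=> /mulIf; apply; rewrite invr_eq0 dnorm_eq0.
apply/lfunP => x; apply: (@ip_inj _ _ ip) => y.
pose D u v := ip (rho u) v - ip (rho' u) v.
(* Polarization: this relation for [x, y] and for [i x, y] yields [2 i D x y = 0]. *)
have DE u v : D u v + D v u = 0.
  have := diag (u + v); rewrite [rho _]linearD [rho' _]linearD.
  rewrite !ipDl !ipDr !diag => E.
  have /eqP := E; rewrite -subr_eq0 => /eqP <-; rewrite /D; ring.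
have DZ k u v : D (k *: u) v = k * D u v by rewrite /D !linearZ /= !ipZl mulrBr.
have DZr k u v : D u (k *: v) = k^* * D u v by rewrite /D !ipZr mulrBr.
have E1 := DE x y; have := DE ('i%C *: x) y; rewrite DZ DZr.
have -> : ('i%C : R[i])^* = - 'i%C by apply/eqP; rewrite eq_complex /= oppr0 !eqxx.
have -> : D y x = - D x y by apply/eqP; rewrite -addr_eq0 addrC E1.
rewrite mulrNN -mulr2n => /eqP; rewrite mulrn_eq0 /= mulf_eq0.
have -> : ('i%C == 0 :> R[i]) = false by rewrite eq_complex /= oner_eq0 andbF.
rewrite /= subr_eq0 => /eqP xy.
by rewrite ipC xy -ipC.
Qed.

End Assignments.

Theorem theorem6p1 (R : realType) (V : vectType R[i]) (ip : {dot V for conjC})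
    (dimV : (3 <= \dim {:V})%N)
    (w : 'End(V) -> {fset 'End(V)} -> R)
    (hw : probability_assignment ip w) :
  [<-> complementary_unitary_invariant ip w;
       context_independent ip w;
       exists! rho : 'End(V), density_operator ip rho /\ represents ip rho w]
  /\
  [<-> two_level_complementary_unitary_invariant ip w;
       context_independent ip w;
       exists! rho : 'End(V), density_operator ip rho /\ represents ip rho w].
Proof.
have rep_inv : (exists! rho : 'End(V),
    density_operator ip rho /\ represents ip rho w) ->
    complementary_unitary_invariant ip w.
  move=> [rho [[_ rep] _]].
  exact: context_independent_invariant (represents_context_independent rep).
split; tfae.
- by move=> inv; apply/two_level_context_independent/invariant_two_level.
- exact: context_independent_density.
- exact: rep_inv.
- exact: two_level_context_independent.
- exact: context_independent_density.
- by move=> /rep_inv/invariant_two_level.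
Qed.
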